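(* Let $2\le N\le 4$, let $1\le R\le\infty$, and let $\Omega=B_R\setminus\overline{B_1}\subset\mathbb{R}^N$. Let $g$ be a nonnegative measurable function on $\Omega$ and let $w$ be a function on $(1,R)$ such that $g(x)\le w(|x|)$ for all $x\in\Omega$. If $$w\in\begin{cases}L^1((1,\infty),r^{N+1}), & N=3,4;\ R=\infty,\\ L^1((1,\infty),r^3\log r), & N=2;\ R=\infty,\\ L^1((1,R)), & 2\le N\le 4;\ R<\infty,\end{cases}$$ then $g$ is admissible.
   Context: $B_\rho$ denotes the open ball of radius $\rho$ centered at the origin in $\mathbb{R}^N$, with $B_\infty=\mathbb{R}^N$. $\mathcal{D}^{2,2}_0(\Omega)$ denotes the completion of $C_c^\infty(\Omega)$ with respect to the norm $\|\Delta u\|_{L^2(\Omega)}$ (for the sets $\Omega$ considered here it is a function space). A function $g$ on $\Omega$ is called admissible if there is a constant $C>0$ such that $$\int_\Omega g(x)u^2\,dx\le C\int_\Omega|\Delta u|^2\,dx\qquad\text{for all }u\in\mathcal{D}^{2,2}_0(\Omega).$$ For an interval $I$ and a nonnegative weight $\rho(r)$, $L^1(I,\rho(r))$ is the space of measurable functions $w$ on $I$ with $\int_I|w(r)|\,\rho(r)\,dr<\infty$. *)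

(* Defs.v *)
From HB Require Import structures.
From mathcomp Require Import all_boot all_order all_algebra.
From mathcomp Require Import all_classical all_reals all_analysis.

Set Implicit Arguments.
Unset Strict Implicit.
Unset Printing Implicit Defensive.

Import Order.TTheory GRing.Theory Num.Theory.
Import numFieldTopology.Exports numFieldNormedType.Exports.

Local Open Scope classical_set_scope.
Local Open Scope ring_scope.

Definition rV_display : measure_display -> measure_display.
Proof. exact. Qed.

(* Product sigma-algebra on 'rV[T]_n, generated by the coordinate maps; for
   T = R this is the Borel sigma-algebra of R^n.                              *)
Section measurable_rV.
Context {d : measure_display} {T : measurableType d} (n : nat).

Definition rV_coord (i : 'I_n) (x : 'rV[T]_n) : T := x ord0 i.

Let rV_set0 : g_sigma_preimage rV_coord set0.
Proof. exact: sigma_algebra0. Qed.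

Let rV_setC A : g_sigma_preimage rV_coord A -> g_sigma_preimage rV_coord (~` A).
Proof. exact: sigma_algebraC. Qed.

Let rV_bigcup (F : (set 'rV[T]_n)^nat) :
  (forall i, g_sigma_preimage rV_coord (F i)) ->
  g_sigma_preimage rV_coord (\bigcup_i (F i)).
Proof. exact: sigma_algebra_bigcup. Qed.

HB.instance Definition _ := @isMeasurable.Build (rV_display d)
  'rV[T]_n (g_sigma_preimage rV_coord) rV_set0 rV_setC rV_bigcup.

End measurable_rV.

Section measurable_rV_theory.
Context {d : measure_display} {T : measurableType d}.

Lemma measurable_rV_coord n (i : 'I_n) :
  measurable_fun [set: 'rV[T]_n] (fun x => x ord0 i).
Proof.
move=> _ Y mY; rewrite setTI; apply: sub_sigma_algebra => /=.
rewrite -bigcup_seq/=; exists i => /=; first by rewrite mem_index_enum.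
by exists Y => //; rewrite setTI.
Qed.

Lemma measurable_fun_rV d' (T' : measurableType d') n (f : T' -> 'rV[T]_n) :
  (forall i, measurable_fun [set: T'] (fun x => f x ord0 i)) ->
  measurable_fun [set: T'] f.
Proof.
move=> mf _ Y mY; rewrite setTI.
pose S : set (set 'rV[T]_n) := [set A | measurable (f @^-1` A)].
suff: S Y by [].
apply: mY; split; first split.
- by rewrite /S /= preimage_set0.
- by move=> A SA; rewrite /S /= setTD; exact: measurableC.
- by move=> F SF; rewrite /S /= preimage_bigcup; exact: bigcupT_measurable.
rewrite -bigcup_seq/= => A [i _] [B mB <-].
by rewrite setTI; have := mf i measurableT _ mB; rewrite setTI.
Qed.

End measurable_rV_theory.

Section lebesgue_rV.
Context {R : realType}.

Definition rV_cons n (p : measurableTypeR R * 'rV[R]_n) : 'rV[R]_n.+1 :=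
  \row_i oapp (fun j => p.2 ord0 j) p.1 (unlift ord0 i).

Definition rV_uncons n (x : 'rV[R]_n.+1) : measurableTypeR R * 'rV[R]_n :=
  (x ord0 ord0, \row_j x ord0 (lift ord0 j)).

Lemma rV_consK n : cancel (@rV_cons n) (@rV_uncons n).
Proof.
move=> [a v]; rewrite /rV_uncons !mxE unlift_none /=; congr pair.
by apply/rowP => j; rewrite !mxE liftK.
Qed.

Lemma measurable_rV_cons n : measurable_fun setT (@rV_cons n).
Proof.
apply: measurable_fun_rV => i.
under eq_fun do rewrite mxE.
case: unliftP => [j _|_] /=; last exact: measurable_fst.
exact: (measurableT_comp (measurable_rV_coord j) measurable_snd).
Qed.

Lemma measurable_rV_uncons n : measurable_fun setT (@rV_uncons n).
Proof.
apply/measurable_fun_pairP; split; first exact: measurable_rV_coord.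
apply: measurable_fun_rV => j /=.
under eq_fun do rewrite mxE.
exact: measurable_rV_coord.
Qed.

Section step.
Context {n : nat} (mu : {sigma_finite_measure set 'rV[R]_n -> \bar R}).

Definition lebesgue_rVS : set 'rV[R]_n.+1 -> \bar R :=
  pushforward (@lebesgue_measure R \x mu)%E (@rV_cons n).

Let lebesgue_rVS0 : lebesgue_rVS set0 = 0%E.
Proof. by rewrite /lebesgue_rVS /pushforward preimage_set0 measure0. Qed.

Let lebesgue_rVS_ge0 A : (0 <= lebesgue_rVS A)%E.
Proof. by rewrite /lebesgue_rVS /pushforward; exact: measure_ge0. Qed.

Let lebesgue_rVS_sigma_additive : semi_sigma_additive lebesgue_rVS.
Proof.
move=> F mF tF mUF; rewrite /lebesgue_rVS /pushforward preimage_bigcup.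
apply: measure_semi_sigma_additive.
- by move=> k; rewrite -[X in measurable X]setTI; exact: measurable_rV_cons.
- apply/trivIsetP => /= i j _ _ ij; rewrite -preimage_setI.
  by move/trivIsetP : tF => /(_ _ _ _ _ ij) ->//; rewrite preimage_set0.
- rewrite -preimage_bigcup -[X in measurable X]setTI.
  exact: measurable_rV_cons.
Qed.

HB.instance Definition _ := isMeasure.Build _ _ _ lebesgue_rVS
  lebesgue_rVS0 lebesgue_rVS_ge0 lebesgue_rVS_sigma_additive.

Let lebesgue_rVS_sigma_finite : sigma_finite setT lebesgue_rVS.
Proof.
have /sigma_finiteP[F [TF ndF Foo]] := sigma_finiteT (@lebesgue_measure R).
have /sigma_finiteP[G [TG ndG Goo]] := sigma_finiteT mu.
exists (fun k => @rV_uncons n @^-1` (F k `*` G k)).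
  rewrite predeqE => x; split=> // _.
  have [k _ Fk] : (\bigcup_k F k) (rV_uncons x).1 by rewrite -TF.
  have [l _ Gl] : (\bigcup_k G k) (rV_uncons x).2 by rewrite -TG.
  exists (maxn k l) => //; split.
  - by move: Fk; exact/subsetPset/ndF/leq_maxl.
  - by move: Gl; exact/subsetPset/ndG/leq_maxr.
move=> k; have [mF Fkoo] := Foo k; have [mG Gkoo] := Goo k; split.
  rewrite -[X in measurable X]setTI.
  by apply: measurable_rV_uncons => //; exact: measurableX.
rewrite /lebesgue_rVS /pushforward -comp_preimage.
rewrite (_ : _ \o _ = id); last by apply/funext => p /=; rewrite rV_consK.
by rewrite preimage_id product_measure1E// lte_mul_pinfty// ge0_fin_numE.
Qed.

HB.instance Definition _ := Measure_isSigmaFinite.Build _ _ _ lebesgue_rVS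
  lebesgue_rVS_sigma_finite.

End step.

(* Lebesgue measure on the Borel sigma-algebra of R^n, as the iterated product
   of the one-dimensional one.                                                *)
Fixpoint lebesgue_rV n : {sigma_finite_measure set 'rV[R]_n -> \bar R} :=
  match n with
  | 0 => (\d_(0 : 'rV[R]_0) : {finite_measure set 'rV[R]_0 -> \bar R})
  | m.+1 => lebesgue_rVS (lebesgue_rV m)
  end.

End lebesgue_rV.

(* A function is Lebesgue measurable iff it agrees almost everywhere with a
   Borel function; the library's integral against a Borel measure, being a
   supremum over Borel simple functions, gives such nonnegative functions their
   Lebesgue integral.                                                         *)
Definition ae_measurable d (T : measurableType d) (R : realType)
    (mu : {measure set T -> \bar R}) (D : set T) (f : T -> R) :=
  exists2 h : T -> R, measurable_fun D h &
    {ae mu, forall x, D x -> f x = h x}.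

Definition weighted_L1 (R : realType) (I : set R) (rho w : R -> R) :=
  ae_measurable (@lebesgue_measure R) I w /\
  (\int[@lebesgue_measure R]_(r in I) (`|w r| * rho r)%:E < +oo)%E.

Section D22.
Context {R : realType} {N : nat}.
Implicit Types (u v phi : 'rV[R]_N -> R) (Omega : set 'rV[R]_N).

Definition enorm (x : 'rV[R]_N) : R := Num.sqrt (\sum_i x ord0 i ^+ 2).

Definition eball (rho : \bar R) : set 'rV[R]_N :=
  [set x | ((enorm x)%:E < rho)%E].

Definition partial (i : 'I_N) u : 'rV[R]_N -> R :=
  fun x => 'D_(delta_mx ord0 i) u x.

Definition partials (s : seq 'I_N) u : 'rV[R]_N -> R := foldr partial u s.

Definition smooth u := forall s : seq 'I_N,
  continuous (partials s u) /\
  forall i x, derivable (partials s u) x (delta_mx ord0 i).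

Definition laplacian u : 'rV[R]_N -> R :=
  fun x => \sum_i partial i (partial i u) x.

(* C_c^oo(Omega), its elements being extended by 0 to the whole space *)
Definition test_function Omega phi :=
  [/\ smooth phi, compact (closure [set x | phi x != 0]) &
      closure [set x | phi x != 0] `<=` Omega].

(* D22_0 Omega u v : u is in the completion of C_c^oo(Omega) for the norm
   ||Laplacian u||_{L^2(Omega)}, realised as a space of functions, and v is its
   Laplacian: some sequence of test functions converges to u in L^1_loc(Omega)
   while its Laplacians converge to v in L^2(Omega). In particular
   ||v||_{L^2(Omega)} is the norm of u in the completion. This realisation is
   meant for sets Omega on which sequences of test functions that are Cauchy for
   the norm converge in L^1_loc(Omega).                                       *)
Definition D22_0 Omega u v :=
  [/\ ae_measurable (lebesgue_rV N) Omega u,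
      ae_measurable (lebesgue_rV N) Omega v &
      exists phi_ : nat -> 'rV[R]_N -> R,
        [/\ forall k, test_function Omega (phi_ k),
            (\int[lebesgue_rV N]_(x in Omega)
               ((laplacian (phi_ k) x - v x) ^+ 2)%:E)%E
               @[k --> \oo] --> 0%E &
            forall K, compact K -> K `<=` Omega ->
              (\int[lebesgue_rV N]_(x in K) `|phi_ k x - u x|%:E)%E
               @[k --> \oo] --> 0%E]].

Definition admissible Omega (g : 'rV[R]_N -> R) :=
  exists2 C : R, 0 < C & forall u v, D22_0 Omega u v ->
    (\int[lebesgue_rV N]_(x in Omega) (g x * u x ^+ 2)%:E <=
     C%:E * \int[lebesgue_rV N]_(x in Omega) (v x ^+ 2)%:E)%E.

End D22.

(* Main.v *)
Require Import Defs.
From mathcomp Require Import all_boot all_order all_algebra.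
From mathcomp Require Import all_classical all_reals all_analysis.
From mathcomp Require Import measurable_realfun ring lra.

Set Implicit Arguments.
Unset Strict Implicit.
Unset Printing Implicit Defensive.

Import Order.TTheory GRing.Theory Num.Theory.
Import numFieldTopology.Exports numFieldNormedType.Exports.

(** For test functions the heart of the matter is a bound for
    [int W(|x|) phi(x)^2 dx] with an arbitrary nonnegative Borel weight [W], and
    it comes from integrating twice along rays.  Let [H] be the sum of the squares
    of the second partial derivatives of [phi].  As [phi] vanishes together with
    its gradient on the unit ball, two integrations along the segment from
    [x / |x|] to [x], the points of which are written [x / s] with
    [1 <= s <= |x| = r], and the Cauchy-Schwarz inequality give
    (lemma [ray_estimate])

      phi(x)^2 <= r^(N+2) K(r) int_1^r s^(-N-1) H(x/s) ds,

    where [K = ln] for [N = 2] and [K = 1] for [N >= 3]; the logarithm is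
    [int_1^r ds/s].  The powers of [s] are split in the Cauchy-Schwarz inequality in
    such a way that the next step produces exactly the measure [H(y) dy].  One
    integrates the estimate against [W(|x|) dx], exchanges the integrals,
    substitutes [x = s y] for each [s], exchanges the integrals again and
    substitutes [r = s |y|] for each [y]; what is left is (lemma
    [weighted_estimate])

      int W(|x|) phi^2 dx <= (int W(r) r^(N+1) K(r) dr) (int H dy).

    Only linear substitutions occur, so spherical coordinates and surface measures
    do not enter.  Two integrations by parts turn [int H] into
    [int (Laplacian phi)^2] (lemma [integral_hessian_sqr]); they rest on
    [int d_i F = 0], a consequence of the translation invariance of the Lebesgue
    measure, and on the symmetry of second derivatives.

    Each of the three integrability conditions on [w] ensures that
    [int w(r) r^(N+1) K(r) dr] is finite: for an infinite outer radius it is that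
    very statement, and for a finite one [r^(N+1) K(r)] is bounded.  As [w] is only
    Lebesgue measurable it is replaced by a Borel majorant [W], which is infinite
    on a null set.

    A pair [(u, v)] of the completion is a limit of test functions [phi_k].  Along
    a subsequence [phi_k] tends to [u] almost everywhere, and Fatou's lemma
    gives [int g u^2 <= 2 C int v^2], where [C = int W(r) r^(N+1) K(r) dr]; the
    factor [2] comes from
    [(Laplacian phi_k)^2 <= 2 (Laplacian phi_k - v)^2 + 2 v^2]. *)

Local Open Scope classical_set_scope.
Local Open Scope ring_scope.

(** * Affine changes of variables in the Lebesgue integral *)

Section affine1.
Context {R : realType}.
Local Notation mu := (@lebesgue_measure R).

Let aff (c b : R) : measurableTypeR R -> measurableTypeR R := fun x => c * x + b.

Let maff c b : measurable_fun setT (aff c b).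
Proof. by apply: measurable_funD => //; apply: measurable_funM. Qed.

Lemma lebesgue_measure_affine (c b : R) (A : set R) : 0 < c -> measurable A ->
  pushforward mu (fun x => c * x + b) A = (c^-1%:E * mu A)%E.
Proof.
move=> c0 mA.
pose k := NngNum (ltW c0).
pose nu : {measure set (measurableTypeR R) -> \bar R} :=
  mscale k (pushforward mu (aff c b)).
have -> : mu A = nu (maff c b) A.
  apply: lebesgue_measure_unique => //= _ [[p q]] _ <-.
  rewrite /nu /= /mscale/= /pushforward.
  have -> : aff c b @^-1` `]p, q]%classic = `](p - b) / c, (q - b) / c]%classic.
    apply/seteqP; split=> x /=; rewrite !in_itv/= /aff ltr_pdivrMr// ler_pdivlMr//;
      by rewrite ltrBlDr lerBrDr [x * c]mulrC.
  rewrite lebesgue_measure_itv/= lebesgue_measure_itv/= !lte_fin.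
  rewrite ltr_pM2r ?invr_gt0// ltrD2r; case: ifP => _; last by rewrite mule0.
  rewrite -!EFinD -EFinM; congr (_%:E); field; exact: lt0r_neq0.
by rewrite /nu /= /mscale/= muleA -EFinM mulVf ?lt0r_neq0// mul1e.
Qed.

Lemma ge0_integral_affine (c b : R) (f : R -> \bar R) : 0 < c ->
  measurable_fun setT f -> (forall x, 0 <= f x)%E ->
  (\int[mu]_x f (c * x + b)%R = c^-1%:E * \int[mu]_x f x)%E.
Proof.
move=> c0 mf f0.
transitivity (\int[pushforward mu (aff c b)]_x f x)%E.
  by rewrite ge0_integral_pushforward//.
have ci0 : 0 <= c^-1 by rewrite invr_ge0 ltW.
rewrite -(ge0_integral_mscale mu measurableT (NngNum ci0))//.
apply: eq_measure_integral => /= A mA _.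
exact: lebesgue_measure_affine.
Qed.

End affine1.

Section rV_integral.
Context {R : realType}.
Local Notation mu := (@lebesgue_measure R).

Lemma ge0_integral_rVS n (f : 'rV[R]_n.+1 -> \bar R) :
  measurable_fun setT f -> (forall x, 0 <= f x)%E ->
  (\int[lebesgue_rV n.+1]_x f x =
   \int[mu]_a \int[lebesgue_rV n]_v f (rV_cons (a, v)))%E.
Proof.
move=> mf f0 /=; rewrite ge0_integral_pushforward//; last exact: measurable_rV_cons.
rewrite preimage_setT (fubini_tonelli1 (f \o @rV_cons R n))//=.
by apply: measurableT_comp => //; exact: measurable_rV_cons.
Qed.

Lemma measurable_rV_affine n (c : R) (b : 'rV[R]_n) :
  measurable_fun setT (fun x : 'rV[R]_n => c *: x + b).
Proof.
apply: measurable_fun_rV => i; under eq_fun do rewrite !mxE.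
by apply: measurable_funD => //; apply: measurable_funM => //; exact: measurable_rV_coord.
Qed.

(** The measure is an iterated product, so the formula follows from the
    one-dimensional one by induction on the dimension and Tonelli's theorem.  It is
    used with [b = 0] for dilations and with [c = 1] for translations. *)
Lemma ge0_integral_rV_affine n (c : R) (b : 'rV[R]_n) (f : 'rV[R]_n -> \bar R) :
  0 < c -> measurable_fun setT f -> (forall x, 0 <= f x)%E ->
  (\int[lebesgue_rV n]_x f (c *: x + b)%R =
   (c ^- n)%:E * \int[lebesgue_rV n]_x f x)%E.
Proof.
move=> c0; elim: n b f => [|n IH] b f mf f0.
  rewrite expr0 invr1 mul1e; apply: eq_integral => x _; congr f.
  by apply/rowP => -[].
have mfc : measurable_fun setT (f \o fun x => c *: x + b).
  by apply: measurableT_comp => //; exact: measurable_rV_affine.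
have E1 := ge0_integral_rVS mfc (fun x => f0 _).
have E2 := ge0_integral_rVS mf f0.
rewrite [LHS]E1 E2 /=.
pose b' := (rV_uncons b).2.
pose F a := (\int[lebesgue_rV n]_v f (rV_cons (a, v)))%E.
have mfC : measurable_fun setT (f \o @rV_cons R n).
  by apply: measurableT_comp => //; exact: measurable_rV_cons.
have mF : measurable_fun setT F.
  exact: (measurable_fun_fubini_tonelli_F (m2 := lebesgue_rV n)
    (f \o @rV_cons R n) mfC (fun x => f0 _)).
have F0 a : (0 <= F a)%E by apply: integral_ge0.
have ci : (0 <= (c ^- n)%:E :> \bar R)%E by rewrite lee_fin invr_ge0 exprn_ge0// ltW.
transitivity (\int[mu]_a ((c ^- n)%:E * F (c * a + b ord0 ord0)%R))%E.
  apply: eq_integral => a _.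
  rewrite /F -(IH b' (fun v => f (rV_cons ((c * a + b ord0 ord0)%R, v))))//; last first.
    by apply: (measurableT_comp (f := f \o @rV_cons R n)); last exact: measurable_pair1.
  apply: eq_integral => v _; congr f; apply/rowP => i; rewrite !mxE.
  by case: unliftP => [j ->|->] /=; rewrite ?mxE.
have mFa : measurable_fun setT (fun a => F (c * a + b ord0 ord0)).
  apply: (measurableT_comp (f := F)) => //.
  by apply: measurable_funD => //; apply: measurable_funM.
rewrite ge0_integralZl//.
rewrite (ge0_integral_affine _ c0 mF F0) muleA -EFinM exprS invfM mulrC//.
Qed.

Definition cube n (L : R) : set 'rV[R]_n := [set x | forall i, `|x ord0 i| <= L].

Lemma measurable_cube n L : measurable (@cube n L).
Proof.
have -> : @cube n L =
    \bigcap_(i in [set: 'I_n]) ((fun x => x ord0 i) @^-1` `[-L, L]%classic).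
  apply/seteqP; split => [x Lx i _|x Lx i] /=.
    by rewrite in_itv/= -ler_norml.
  by have := Lx i I; rewrite /= in_itv/= -ler_norml.
apply: fin_bigcap_measurable => // i _.
by rewrite -[X in measurable X]setTI; exact: measurable_rV_coord.
Qed.

Lemma cube_finite n L : (lebesgue_rV n (@cube n L) < +oo)%E.
Proof.
elim: n => [|n IH].
  by rewrite /= diracE; case: (_ \in _); exact: ltry.
rewrite /= /lebesgue_rVS /pushforward.
have -> : @rV_cons R n @^-1` cube L = `[-L, L]%classic `*` cube L.
  apply/seteqP; split => [[a v] /= Lx|[a v] /= [Ha Hv] i].
    split => [|i] /=.
      by have := Lx ord0; rewrite /rV_cons mxE unlift_none/= in_itv/= -ler_norml.
    by have := Lx (lift ord0 i); rewrite /rV_cons mxE liftK.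
  rewrite /rV_cons mxE; case: unliftP => [j _|_] /=; first exact: Hv.
  by move: Ha; rewrite /= in_itv/= -ler_norml.
rewrite product_measure1E//; last exact: measurable_cube.
apply: lte_mul_pinfty => //.
suff: mu `[- L, L]%classic \is a fin_num by [].
by rewrite lebesgue_measure_itv/=; case: ifP => _.
Qed.

End rV_integral.

(** * Borel sets and the Euclidean norm *)

Lemma continuous_sumr (T : topologicalType) (R : realType) (I : Type) (r : seq I)
    (F : I -> T -> R) :
  (forall i, continuous (F i)) -> continuous (fun x => \sum_(i <- r) F i x).
Proof.
by move=> cF; apply: continuous_big => // x; exact: add_continuous.
Qed.

Section rV_topology.
Context {R : realType} (n : nat).
Implicit Types (x y : 'rV[R]_n).

(** An open set is the union of the cubes with rational centre and radius
    [1 / (k + 1)] that it contains, and there are countably many of them. *)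
Lemma open_measurable_rV (U : set 'rV[R]_n) : open U -> measurable U.
Proof.
move=> oU.
pose box (p : 'rV[rat]_n * nat) : set 'rV[R]_n :=
  [set x | forall i, `|x ord0 i - ratr (p.1 ord0 i)| < p.2.+1%:R^-1].
have mbox p : measurable (box p).
  have -> : box p = \bigcap_(i in [set: 'I_n])
      ((fun x => x ord0 i) @^-1` ball (ratr (p.1 ord0 i) : R) p.2.+1%:R^-1).
    apply/seteqP; split => [x Lx i _|x Lx i] /=.
      by rewrite /ball/= distrC.
    by have := Lx i I; rewrite /= /ball/= distrC.
  apply: fin_bigcap_measurable => // i _.
  rewrite -[X in measurable X]setTI; apply: measurable_rV_coord => //.
  exact: measurable_ball.
have -> : U = \bigcup_p (if `[< box p `<=` U >] then box p else set0).
  apply/seteqP; split=> [x Ux|x [p _]]; last by case: asboolP => // pU /pU.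
  have /nbhs_ballP[e /= e0 xeU] := open_nbhs_nbhs (conj oU Ux).
  (* half the radius, for x and y are each that close to the rational centre *)
  have [k ke] : exists k : nat, k.+1%:R^-1 < e / 2 :> R.
    have /ltr_add_invr[k] : 0 < e / 2 by rewrite divr_gt0.
    by rewrite add0r; exists k.
  have /choice[q Hq] : forall i, exists q : rat, `|x ord0 i - ratr q| < k.+1%:R^-1.
    move=> i; have : x ord0 i - k.+1%:R^-1 < x ord0 i + k.+1%:R^-1.
      by rewrite ltrD2l gtrN// invr_gt0.
    move=> /rat_in_itvoo[q]; rewrite in_itv/= => /andP[q1 q2]; exists q.
    by rewrite distrC ltr_distl q1.
  have bq i : `|x ord0 i - ratr ((\row_i q i : 'rV[rat]_n) ord0 i)| < k.+1%:R^-1.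
    by rewrite mxE.
  exists ((\row_i q i), k) => //; case: asboolP => [_ //|]; case.
  move=> y by_; apply: xeU; split => // a i; rewrite (ord1 a) /ball/=.
  have := by_ i; rewrite /= mxE => yq; have := Hq i => xq.
  rewrite (_ : _ - _ = (x ord0 i - ratr (q i)) - (y ord0 i - ratr (q i))); last by ring.
  by rewrite (le_lt_trans (ler_normB _ _))// (splitr e) ltrD// (lt_trans _ ke).
apply: countable_bigcupT_measurable => [|p]; first exact: countableP.
by case: asboolP.
Qed.

Lemma closed_measurable_rV (U : set 'rV[R]_n) : closed U -> measurable U.
Proof.
move=> cU; rewrite -(setCK U); apply: measurableC.
by apply: open_measurable_rV; exact: closed_openC.
Qed.

Lemma continuous_measurable_rV (f : 'rV[R]_n -> R) :
  continuous f -> measurable_fun setT f.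
Proof.
move=> /continuousP cf; apply: (measurability _ (RGenOpens.measurableE R)).
move=> _ [_ [a [b ->] <-]]; rewrite setTI; apply: open_measurable_rV.
exact/cf/interval_open.
Qed.

Lemma enorm_ge0 x : 0 <= enorm x. Proof. exact: sqrtr_ge0. Qed.

Lemma enorm_sqr x : enorm x ^+ 2 = \sum_i x ord0 i ^+ 2.
Proof. by rewrite sqr_sqrtr// sumr_ge0// => i _; exact: sqr_ge0. Qed.

Lemma enormZ (c : R) x : 0 <= c -> enorm (c *: x) = c * enorm x.
Proof.
move=> c0; rewrite /enorm (eq_bigr (fun i => c ^+ 2 * x ord0 i ^+ 2)); last first.
  by move=> i _; rewrite mxE exprMn.
by rewrite -mulr_sumr sqrtrM ?sqr_ge0// sqrtr_sqr ger0_norm.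
Qed.

Lemma coord_le_enorm x i : `|x ord0 i| <= enorm x.
Proof.
rewrite -sqrtr_sqr ler_sqrt; last by rewrite sumr_ge0// => j _; exact: sqr_ge0.
by rewrite (bigD1 i)//= lerDl sumr_ge0// => j _; exact: sqr_ge0.
Qed.

Lemma enorm_continuous : continuous (@enorm R n).
Proof.
have cX i : continuous (fun x : 'rV[R]_n => x ord0 i ^+ 2).
  move=> x.
  apply: (@continuous_comp _ _ _ (fun x : 'rV[R]_n => x ord0 i) (fun z => z ^+ 2)).
    exact: coord_continuous.
  exact: exprn_continuous.
move=> x; apply: continuous_comp; last exact: sqrt_continuous.
exact: continuous_sumr.
Qed.

Lemma measurable_enorm : measurable_fun setT (@enorm R n).
Proof. by apply: continuous_measurable_rV; exact: enorm_continuous. Qed.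

End rV_topology.

(** * Directional derivatives of functions with continuous partials *)

Section directional.
Context {R : realType} {n : nat}.
Implicit Types (F : 'rV[R]_n -> R) (x v w : 'rV[R]_n).

Lemma is_derive_line F x v (s : R) : derivable F (x + s *: v) v ->
  is_derive s 1 (fun t => F (x + t *: v)) ('D_v F (x + s *: v)).
Proof.
move=> dF.
have E : (fun h : R => h^-1 *:
      (((fun t => F (x + t *: v)) \o shift s) (h *: 1) - F (x + s *: v))) =
    (fun h : R => h^-1 *: ((F \o shift (x + s *: v)) (h *: v) - F (x + s *: v))).
  apply/funext => h /=; congr (_ *: (F _ - _)).
  by rewrite [h%:A]mulr1 scalerDl addrCA.
by split; rewrite /derivable /derive/= E.
Qed.

Lemma derive_MVT F x v (h : R) : (forall y, derivable F y v) ->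
  exists2 c : R, `|c| <= `|h| & F (x + h *: v) - F x = h * 'D_v F (x + c *: v).
Proof.
move=> dF.
pose g (t : R) := F (x + t *: v); pose dg (t : R) : R := 'D_v F (x + t *: v).
have dgP (t : R) : is_derive t 1 g (dg t) by exact: is_derive_line.
have cg a b : {within `[a, b], continuous g}.
  by apply: derivable_within_continuous => t _; exact: (@ex_derive _ _ _ _ _ _ _ (dgP t)).
have [h0|h0] := leP 0 h.
  have [c] := MVT_segment h0 (fun t _ => dgP t) (cg _ _).
  rewrite in_itv/= => /andP[c0 ch] E; exists c; first by rewrite !ger0_norm.
  by move: E; rewrite /g /dg scale0r addr0 subr0 => ->; rewrite mulrC.
have [c] := MVT_segment (ltW h0) (fun t _ => dgP t) (cg _ _).
rewrite in_itv/= => /andP[c0 ch] E; exists c.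
  by rewrite (ler0_norm ch) (ler0_norm (ltW h0)) lerN2.
by move: E; rewrite /g /dg scale0r addr0 sub0r mulrN -opprB => /oppr_inj ->; rewrite mulrC.
Qed.

(** The increment along [h (v + a w)] is split at [x + h v].  The second part is
    [h a] times a derivative at an intermediate point, by the mean value theorem,
    and the continuity of ['D_w F] takes it to its value at [x]. *)
Lemma is_derive_dirD F x v w (a : R) : derivable F x v ->
  (forall y, derivable F y w) -> {for x, continuous ('D_w F)} ->
  is_derive x (v + a *: w) F ('D_v F x + a * 'D_w F x).
Proof.
move=> dv dw cw.
have /choice[c Hc] : forall h : R, exists c : R, `|c| <= `|h * a| /\
    F (x + h *: v + (h * a) *: w) - F (x + h *: v) =
    (h * a) * 'D_w F (x + h *: v + c *: w).
  by move=> h; have [c c1 c2] := derive_MVT (x + h *: v) (h * a) dw; exists c.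
have cvh : (fun h : R => x + h *: v + c h *: w) @ 0^' --> x.
  have h0 : (fun h : R => h) @ 0^' --> (0 : R).
    exact: (cvg_within_filter (f := id) (F := nbhs (0 : R))).
  have ch0 : c @ 0^' --> (0 : R).
    apply/norm_cvg0P.
    apply: (@squeeze_cvgr _ _ _ _ (fun=> 0) (fun h => `|h * a|)).
    - by near=> h; rewrite normr_ge0; exact: (Hc h).1.
    - exact: cvg_cst.
    - rewrite -[X in _ --> X](@normr0 R R); apply: cvg_norm.
      by rewrite -[X in _ --> X](mul0r a); exact: cvgMr_tmp.
  rewrite -[X in _ --> X]addr0; apply: cvgD.
    rewrite -[X in _ --> X]addr0; apply: cvgD; first exact: cvg_cst.
    by rewrite -[X in _ --> X](scale0r v); exact: cvgZr_tmp.
  by rewrite -[X in _ --> X](scale0r w); exact: cvgZr_tmp.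
have L : (fun h : R => h^-1 *: ((F \o shift x) (h *: (v + a *: w)) - F x)) @ 0^'
    --> 'D_v F x + a * 'D_w F x.
  have -> : (fun h : R => h^-1 *: ((F \o shift x) (h *: (v + a *: w)) - F x)) =
    (fun h : R => h^-1 *: ((F \o shift x) (h *: v) - F x) +
             (h^-1 * h) * (a * 'D_w F (x + h *: v + c h *: w))).
    apply/funext => h /=.
    rewrite -mulrA [h * (a * _)]mulrA -(Hc h).2 -[_ *: _]/(_ * _) -[_ *: (_ - _)]/(_ * _).
    by rewrite -mulrDr scalerDr scalerA [_ + x]addrC addrA [h *: v + x]addrC; ring.
  apply: cvgD; first exact: dv.
  have lim2 : (fun h : R => a * 'D_w F (x + h *: v + c h *: w)) @ 0^' --> a * 'D_w F x.
    by apply: cvgMl_tmp; apply: (cvg_comp _ _ cvh cw).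
  apply: cvg_trans lim2; apply: near_eq_cvg; near=> h.
  rewrite mulVf ?mul1r//; near: h; exact: nbhs_dnbhs_neq.
split; first by apply/cvg_ex; eexists; exact: L.
exact: cvg_lim L.
Unshelve. all: by end_near. Qed.


(** Continuous partial derivatives give all directional derivatives: the
    coordinates of [v] are added one at a time. *)
Lemma is_derive_gradient F x v :
  (forall i y, derivable F y (delta_mx ord0 i)) ->
  (forall i, continuous (partial i F)) ->
  is_derive x v F (\sum_i v ord0 i * partial i F x).
Proof.
move=> dF cF; rewrite {1}(row_sum_delta v).
elim: (index_enum _) => [|i r IH].
  by rewrite !big_nil; exact: is_derive0.
rewrite !big_cons addrC [X in is_derive _ _ _ X]addrC.
case: IH => d1 <-.
exact: (is_derive_dirD (v ord0 i) d1 (dF i) (cF i x)).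
Qed.

Lemma is_derive_ray F x (t : R) :
  (forall i y, derivable F y (delta_mx ord0 i)) ->
  (forall i, continuous (partial i F)) ->
  is_derive t 1 (fun s => F (s *: x)) (\sum_i x ord0 i * partial i F (t *: x)).
Proof.
move=> dF cF; have [d1 e1] := is_derive_gradient (t *: x) x dF cF.
rewrite -e1 -[t *: x]add0r.
under eq_fun do rewrite -[_ *: x]add0r.
by apply: is_derive_line; rewrite add0r.
Qed.

(** Mean value theorem in the direction [v] for [y |-> F (y + h w) - F y], then in
    the direction [w] for ['D_v F]. *)
Lemma second_difference F x v w (h : R) :
  (forall y, derivable F y v) -> (forall y, derivable ('D_v F) y w) ->
  exists c d : R, [/\ `|c| <= `|h|, `|d| <= `|h| &
    F (x + h *: v + h *: w) - F (x + h *: v) - F (x + h *: w) + F x =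
    h ^+ 2 * 'D_w ('D_v F) (x + c *: v + d *: w)].
Proof.
move=> dv dw; pose G y := F (y + h *: w) - F y.
have dG y : is_derive y v G ('D_v F (y + h *: w) - 'D_v F y).
  have [d1 d2] : is_derive (y + h *: w) v F ('D_v F (y + h *: w)) by split.
  have d3 : is_derive y v (fun y => F (y + h *: w)) ('D_v F (y + h *: w)).
    have E : (fun k : R => k^-1 *:
          (((fun y => F (y + h *: w)) \o shift y) (k *: v) - F (y + h *: w))) =
        (fun k : R => k^-1 *: ((F \o shift (y + h *: w)) (k *: v) - F (y + h *: w))).
      by apply/funext => k /=; rewrite addrA.
    by split; rewrite /derivable /derive/= E.
  have d4 : is_derive y v F ('D_v F y) by split.
  have := is_deriveB d3 d4.
  set G' := (_ - F); have -> : G' = G by apply/funext => z.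
  by [].
have [c c1 c2] := derive_MVT x h (fun y => @ex_derive _ _ _ _ _ _ _ (dG y)).
have [d d1 d2] := derive_MVT (x + c *: v) h dw.
exists c, d; split => //.
rewrite expr2 -mulrA -d2; have := derive_val (is_derive := dG (x + c *: v)).
move=> E; move: c2; rewrite E => <-; rewrite /G; ring.
Qed.

(** Symmetry of second derivatives: the second difference does not depend on the
    order of the two directions, and divided by [h ^+ 2] it tends to either mixed
    derivative. *)
Lemma partialC F i j x :
  (forall y, derivable F y (delta_mx ord0 i)) ->
  (forall y, derivable F y (delta_mx ord0 j)) ->
  (forall y, derivable (partial i F) y (delta_mx ord0 j)) ->
  (forall y, derivable (partial j F) y (delta_mx ord0 i)) ->
  {for x, continuous (partial i (partial j F))} ->
  {for x, continuous (partial j (partial i F))} ->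
  partial i (partial j F) x = partial j (partial i F) x.
Proof.
move=> di dj dij dji cij cji.
pose h (k : nat) : R := k.+1%:R^-1.
have h0 : h @ \oo --> 0 by exact: cvg_harmonic.
pose v : 'rV[R]_n := delta_mx ord0 i; pose w : 'rV[R]_n := delta_mx ord0 j.
pose S k := F (x + h k *: v + h k *: w) - F (x + h k *: v) - F (x + h k *: w) + F x.
have lim u u' : (forall y, derivable F y u) -> (forall y, derivable ('D_u F) y u') ->
    {for x, continuous ('D_u' ('D_u F))} ->
    (fun k => (F (x + h k *: u + h k *: u') - F (x + h k *: u) - F (x + h k *: u') + F x)
       / h k ^+ 2) @ \oo --> 'D_u' ('D_u F) x.
  move=> du du' cu.
  have /choice[c /choice[d H]] k := second_difference x (h k) du du'.
  have small (e : nat -> R) : (forall k, `|e k| <= `|h k|) -> e @ \oo --> 0.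
    move=> eh; apply/norm_cvg0P; apply: (@squeeze_cvgr _ _ _ _ (fun=> 0) (fun k => `|h k|)).
    - by near=> k; rewrite normr_ge0; exact: eh.
    - exact: cvg_cst.
    - by rewrite -[X in _ --> X](@normr0 R R); apply: cvg_norm.
  have c0 : c @ \oo --> 0 by apply: small => k; case: (H k).
  have d0 : d @ \oo --> 0 by apply: small => k; case: (H k).
  have cv : (fun k => x + c k *: u + d k *: u') @ \oo --> x.
    rewrite -[X in _ --> X]addr0; apply: cvgD.
      rewrite -[X in _ --> X]addr0; apply: cvgD; first exact: cvg_cst.
      by rewrite -[X in _ --> X](scale0r u); exact: cvgZr_tmp.
    by rewrite -[X in _ --> X](scale0r u'); exact: cvgZr_tmp.
  rewrite (_ : (fun k => _) = (fun k => 'D_u' ('D_u F) (x + c k *: u + d k *: u'))).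
    exact: (cvg_comp _ _ cv cu).
  apply/funext => k; have [_ _ ->] := H k.
  by rewrite mulrC mulKf// expf_neq0// invr_neq0.
have L1 := lim w v dj dji cij.
have L2 := lim v w di dij cji.
have SE : (fun k => (F (x + h k *: w + h k *: v) - F (x + h k *: w)
    - F (x + h k *: v) + F x) / h k ^+ 2) = (fun k => S k / h k ^+ 2).
  apply/funext => k; congr (_ / _); rewrite /S [x + h k *: w + _]addrAC.
  by rewrite [in LHS](addrAC (F _)).
rewrite SE in L1.
exact: (cvg_unique _ L1 L2).
Unshelve. all: by end_near. Qed.

Lemma partial_eq0_outside (S : set 'rV[R]_n) F i : closed S ->
  (forall x, ~ S x -> F x = 0) -> forall x, ~ S x -> partial i F x = 0.
Proof.
move=> cS F0 x nSx; rewrite /partial (@near_eq_derive _ _ _ F (cst 0)).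
  exact: derive_cst.
have := open_nbhs_nbhs (conj (closed_openC cS) nSx).
by apply: filterS => y /= nSy; exact: F0.
Qed.

End directional.

(** * Integrals of partial derivatives *)

Section integration_by_parts.
Context {R : realType} {n : nat}.
Implicit Types (F G : 'rV[R]_n -> R) (L : R).
Local Notation mu := (lebesgue_rV n).

Definition cube_supported L F := continuous F /\ forall x, ~ cube L x -> F x = 0.

Lemma compact_cube L : compact (@cube R n L).
Proof.
have -> : @cube R n L = [set v | forall i, `[(- L), L]%classic (v ord0 i)].
  by apply/seteqP; split=> x /= Lx i; have := Lx i; rewrite /= in_itv/= -ler_norml.
by apply: (@rV_compact _ _ (fun=> `[(- L), L]%classic)) => i; exact: segment_compact.
Qed.

Lemma cube_supported_bounded L F : cube_supported L F ->
  exists2 M : R, 0 <= M & forall x, `|F x| <= M.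
Proof.
move=> [cF F0].
have /compact_bounded[M [_ HM]] : compact (F @` cube L).
  by apply: continuous_compact; [exact: continuous_subspaceT|exact: compact_cube].
exists (`|M| + 1) => [|x]; first by rewrite addr_ge0.
have [Lx|/F0 ->] := pselect (cube L x); last by rewrite normr0 addr_ge0.
by apply: (HM (`|M| + 1)); [rewrite (le_lt_trans (ler_norm M))// ltrDl|exists x].
Qed.

Lemma integrable_bounded_cube F L (M : R) : measurable_fun setT F ->
  (forall x, `|F x| <= M) -> (forall x, ~ cube L x -> F x = 0) ->
  mu.-integrable setT (EFin \o F).
Proof.
move=> mF FM F0.
have -> : EFin \o F = (EFin \o F) \_ (cube L).
  apply/funext => x; rewrite patchE; case: ifPn => //.
  by rewrite notin_setE => /F0 /= ->.
apply: (integrable_mkcond _ _).1; first exact: measurable_cube.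
apply: (@measurable_bounded_integrable _ _ _ mu F (cube L)).
- exact: measurable_cube.
- exact: cube_finite.
- exact: measurable_funS mF.
- by exists M; split; [exact: num_real|move=> K MK x _ /=; rewrite (le_trans (FM x))// ltW].
Qed.

Lemma cube_supported_integrable L F : cube_supported L F ->
  mu.-integrable setT (EFin \o F).
Proof.
move=> cF; have [M _ HM] := cube_supported_bounded cF.
apply: (integrable_bounded_cube _ HM cF.2).
by apply: continuous_measurable_rV; exact: cF.1.
Qed.

Lemma cube_supportedM L F G : cube_supported L F -> continuous G ->
  cube_supported L (fun x => F x * G x).
Proof.
move=> [cF F0] cG; split=> [x|x /F0 ->]; last by rewrite mul0r.
by apply: continuousM; [exact: cF|exact: cG].
Qed.

Lemma integral_translate F (b : 'rV[R]_n) : measurable_fun setT F ->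
  (\int[mu]_x (F (x + b)%R)%:E = \int[mu]_x (F x)%:E)%E.
Proof.
move=> mF.
have T (H : 'rV[R]_n -> \bar R) : measurable_fun setT H -> (forall x, 0 <= H x)%E ->
    (\int[mu]_x H (x + b)%R = \int[mu]_x H x)%E.
  move=> mH H0; have := ge0_integral_rV_affine b ltr01 mH H0.
  rewrite expr1n invr1 mul1e => <-.
  by apply: eq_integral => x _; rewrite scale1r.
rewrite integralE [RHS]integralE; congr (_ - _)%E.
  have mFp : measurable_fun setT (EFin \o F)^\+%E.
    by apply: measurable_funepos; exact/measurable_EFinP.
  rewrite -[RHS](T _ mFp); first by apply: eq_integral => x _; rewrite !funeposE.
  by move=> x; exact: funepos_ge0.
have mFn : measurable_fun setT (EFin \o F)^\-%E.
  by apply: measurable_funeneg; exact/measurable_EFinP.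
rewrite -[RHS](T _ mFn); first by apply: eq_integral => x _; rewrite !funenegE.
by move=> x; exact: funeneg_ge0.
Qed.

(** By translation invariance the difference quotients of [F] have integral zero.
    They are bounded by the supremum of the partial derivative and live in a fixed
    cube, so dominated convergence applies. *)
Lemma integral_partial L F i : cube_supported L F ->
  (forall y, derivable F y (delta_mx ord0 i)) -> cube_supported L (partial i F) ->
  \int[mu]_x partial i F x = 0.
Proof.
move=> cF dF cP; set e : 'rV[R]_n := delta_mx ord0 i.
have [M M0 HM] := cube_supported_bounded cP.
have mF := continuous_measurable_rV cF.1.
have mP := continuous_measurable_rV cP.1.
pose h (k : nat) : R := k.+1%:R^-1.
have h0 k : 0 < h k by rewrite invr_gt0.
have h1 k : h k <= 1 by rewrite invf_le1// ler1n.
pose f k (x : 'rV[R]_n) : R := (h k)^-1 * (F (x + h k *: e) - F x).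
have mFt k : measurable_fun setT (fun x : 'rV[R]_n => F (x + h k *: e)).
  apply: (measurableT_comp (f := F)) => //.
  rewrite (_ : (fun x : 'rV[R]_n => _) = fun x => 1 *: x + h k *: e).
    exact: measurable_rV_affine.
  by apply/funext => x; rewrite scale1r.
have mf k : measurable_fun setT (f k).
  by apply: measurable_funM => //; exact: measurable_funB.
have fM k x : `|f k x| <= M.
  have [c _ E] := derive_MVT x (h k) dF.
  by rewrite /f E mulKf ?gt_eqF//; exact: HM.
have f0 k x : ~ cube (L + 1) x -> f k x = 0.
  move=> nLx; have nc : ~ cube L x.
    by move=> Lx; apply: nLx => j; rewrite (le_trans (Lx j))// lerDl.
  rewrite /f (cF.2 _ nc) cF.2 ?subr0 ?mulr0// => Lx; apply: nLx => j.
  have t1 : `|h k * e ord0 j| <= 1.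
    rewrite normrM (ger0_norm (ltW (h0 k))) mulr_ile1// ?(ltW (h0 k))// mxE.
    by case: (_ && _); rewrite ?normr1 ?normr0.
  have := Lx j; rewrite 2!mxE => H.
  have -> : x ord0 j = (x ord0 j + h k * e ord0 j) - h k * e ord0 j by rewrite addrK.
  by rewrite (le_trans (ler_normB _ _))// lerD.
have int0 k : (\int[mu]_x (f k x)%:E = 0)%E.
  have iF := cube_supported_integrable cF.
  have iFt : mu.-integrable setT (EFin \o (fun x : 'rV[R]_n => F (x + h k *: e))).
    apply/integrableP; split; first exact/measurable_EFinP.
    have /integrableP[_] := iF; apply: le_lt_trans.
    rewrite le_eqVlt; apply/orP; left; apply/eqP.
    have mN : measurable_fun setT (fun x => `|F x|) by exact: measurableT_comp.
    exact: (@integral_translate (fun x => `|F x|) (h k *: e) mN).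
  rewrite /f; under eq_integral do rewrite EFinM EFinB.
  rewrite integralZl//; last by apply: integrableB.
  rewrite integralB_EFin// integral_translate// subee ?mule0//.
  exact: integrable_fin_num.
have [_ _] : [/\ mu.-integrable setT (EFin \o partial i F),
  [sequence \int[mu]_x `|(f k x)%:E - (partial i F x)%:E|]_k%E @ \oo --> 0%E &
  [sequence \int[mu]_x (f k x)%:E]_k%E @ \oo --> (\int[mu]_x (partial i F x)%:E)%E].
  apply: (@dominated_convergence _ _ _ mu setT measurableT (fun k x => (f k x)%:E)
    (EFin \o partial i F) (fun x => (M * \1_(cube (L + 1)) x)%:E)) => //.
  - by move=> k; exact/measurable_EFinP.
  - exact/measurable_EFinP.
  - apply: aeW => x _; apply: cvg_EFin; first exact: nearW.
    have /choice[c Hc] k : exists c : R, `|c| <= `|h k| /\ f k x = partial i F (x + c *: e).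
      have [c c1 c2] := derive_MVT x (h k) dF; exists c; split => //.
      by rewrite /f c2 mulKf// gt_eqF.
    have c0 : c @ \oo --> 0.
      apply/norm_cvg0P; apply: (@squeeze_cvgr _ _ _ _ (fun=> 0) h).
      + by near=> k; rewrite normr_ge0/= (le_trans (Hc k).1)// ger0_norm// ltW.
      + exact: cvg_cst.
      + exact: cvg_harmonic.
    have cx : (fun k => x + c k *: e) @ \oo --> x.
      rewrite -[X in _ --> X]addr0; apply: cvgD; first exact: cvg_cst.
      by rewrite -[X in _ --> X](scale0r e); exact: cvgZr_tmp.
    rewrite [X in X @ _](_ : _ = (fun k => partial i F (x + c k *: e))); last first.
      by apply/funext => k /=; exact: (Hc k).2.
    exact: (cvg_comp _ _ cx (cP.1 x)).
  - apply: (@integrable_bounded_cube _ (L + 1) M).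
    + by apply: measurable_funM => //; apply: measurable_indic; exact: measurable_cube.
    + by move=> x; rewrite indicE; case: (_ \in _); rewrite ?mulr1 ?mulr0 ?normr0 ?ger0_norm.
    + by move=> x nx; rewrite indicE memNset// mulr0.
  - apply: aeW => x k _; rewrite lee_fin indicE.
    have [Lx|/f0 ->] := pselect (cube (L + 1) x); first by rewrite mem_set// mulr1.
    by rewrite normr0 mulr_ge0.
rewrite (_ : (fun k => _) = (fun=> 0%E)); last by apply/funext => k; exact: int0.
move=> /cvg_lim; rewrite lim_cst// => E; rewrite /Rintegral -E//.
Unshelve. all: by end_near. Qed.

End integration_by_parts.

(** * The Hessian and the Laplacian have the same L^2 norm *)

(** Cauchy-Schwarz, from the sum of the squares of [a_i b_j - a_j b_i]. *)
Lemma sqr_sumM_le (R : realType) (I : finType) (a b : I -> R) :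
  (\sum_i a i * b i) ^+ 2 <= (\sum_i a i ^+ 2) * (\sum_i b i ^+ 2).
Proof.
have : 0 <= \sum_i \sum_j (a i * b j - a j * b i) ^+ 2.
  by apply: sumr_ge0 => i _; apply: sumr_ge0 => j _; exact: sqr_ge0.
have -> : \sum_i \sum_j (a i * b j - a j * b i) ^+ 2 =
  ((\sum_i a i ^+ 2) * (\sum_i b i ^+ 2) - (\sum_i a i * b i) ^+ 2) *+ 2.
  have E1 : (\sum_i a i ^+ 2) * (\sum_i b i ^+ 2) = \sum_i \sum_j a i ^+ 2 * b j ^+ 2.
    by rewrite mulr_suml; apply: eq_bigr => i _; rewrite mulr_sumr.
  have E2 : (\sum_i a i ^+ 2) * (\sum_i b i ^+ 2) = \sum_i \sum_j a j ^+ 2 * b i ^+ 2.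
    by rewrite E1 exchange_big.
  have E3 : (\sum_i a i * b i) ^+ 2 = \sum_i \sum_j (a i * b i) * (a j * b j).
    by rewrite expr2 mulr_suml; apply: eq_bigr => i _; rewrite mulr_sumr.
  rewrite mulrnBl mulr2n {1}E1 E2 E3 mulr2n opprD -!sumrN -!big_split/=.
  apply: eq_bigr => i _; rewrite -!sumrN -!big_split/=.
  apply: eq_bigr => j _; ring.
by rewrite pmulrn_lge0// subr_ge0.
Qed.

Section hessian.
Context {R : realType} {n : nat}.
Implicit Types (F G phi : 'rV[R]_n -> R) (L : R).
Local Notation mu := (lebesgue_rV n).

Lemma integration_by_parts L F G i : cube_supported L F -> cube_supported L (partial i F) ->
  continuous G -> continuous (partial i G) ->
  (forall y, derivable F y (delta_mx ord0 i)) ->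
  (forall y, derivable G y (delta_mx ord0 i)) ->
  \int[mu]_x (partial i F x * G x) = - \int[mu]_x (F x * partial i G x).
Proof.
move=> cF cPF cG cPG dF dG.
have iFG := cube_supported_integrable (cube_supportedM cPF cG).
have iGF := cube_supported_integrable (cube_supportedM cF cPG).
have E : partial i (fun x => F x * G x) =
    (fun x => partial i F x * G x + F x * partial i G x).
  apply/funext => x; rewrite /partial (@deriveM _ _ F G)//.
  by rewrite -[_ *: _]/(_ * _) -[X in _ + X]/(_ * _) addrC [X in X + _]mulrC.
have c1 := cube_supportedM cPF cG; have c2 := cube_supportedM cF cPG.
have : \int[mu]_x partial i (fun x => F x * G x) x = 0.
  apply: (@integral_partial _ _ L); first exact: cube_supportedM.
    by move=> y; exact: derivableM.
  rewrite E; split=> [x|x nx]; last by rewrite c1.2// c2.2// addr0.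
  exact: (continuousD (c1.1 x) (c2.1 x)).
by rewrite E RintegralD// => /eqP; rewrite addr_eq0 => /eqP.
Qed.

Definition hessian_sqr phi x := \sum_i \sum_j partial i (partial j phi) x ^+ 2.

Lemma cube_supported_partials L phi s : smooth phi -> (forall x, ~ cube L x -> phi x = 0) ->
  cube_supported L (partials s phi).
Proof.
move=> sphi phi0; split; first exact: (sphi s).1.
elim: s => [|i s IH] //=; apply: partial_eq0_outside IH.
by apply: compact_closed; [exact: norm_hausdorff|exact: compact_cube].
Qed.

(** Integrating by parts in [x_i], exchanging derivatives and integrating by parts
    in [x_j] moves one derivative of each factor to the other one. *)
Lemma integral_hessian_entry L phi i j : smooth phi ->
  (forall x, ~ cube L x -> phi x = 0) ->
  \int[mu]_x (partial i (partial j phi) x * partial i (partial j phi) x) =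
  \int[mu]_x (partial i (partial i phi) x * partial j (partial j phi) x).
Proof.
move=> sphi phi0.
have cc s : cube_supported L (partials s phi) by exact: cube_supported_partials.
have c s : continuous (partials s phi) by case: (sphi s).
have d s k y : derivable (partials s phi) y (delta_mx ord0 k) by case: (sphi s).
move: (cc [:: j]) (cc [:: i; j]) (cc [:: j; j]) => /= cj cij cjj.
move: (c [:: i; j]) (c [:: i; i; j]) (c [:: i; i]) (c [:: j; i; i]) => /= kij kiij kii kjii.
move: (d [:: j]) (d [:: i; j]) (d [:: i; i]) => /= dj dij dii.
apply: etrans (integration_by_parts cj cij kij kiij (dj i) (dij i)) _.
have -> : partial i (partial i (partial j phi)) = partial j (partial i (partial i phi)).
  have -> : partial i (partial j phi) = partial j (partial i phi).
    apply/funext => x; apply: partialC.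
    - exact: (d [::] i).
    - exact: (d [::] j).
    - exact: (d [:: i] j).
    - exact: (d [:: j] i).
    - exact: (c [:: i; j]).
    - exact: (c [:: j; i]).
  apply/funext => x; apply: partialC.
  - exact: (d [:: i] i).
  - exact: (d [:: i] j).
  - exact: (d [:: i; i] j).
  - exact: (d [:: j; i] i).
  - exact: (c [:: i; j; i]).
  - exact: (c [:: j; i; i]).
apply: etrans (esym (integration_by_parts cj cjj kii kjii (dj j) (dii j))) _.
by apply: eq_Rintegral => x _; exact: mulrC.
Qed.

Lemma integral_hessian_sqr L phi : smooth phi -> (forall x, ~ cube L x -> phi x = 0) ->
  (\int[mu]_x (hessian_sqr phi x)%:E = \int[mu]_x (laplacian phi x ^+ 2)%:E)%E.
Proof.
move=> sphi phi0.
have cc s : cube_supported L (partials s phi) by exact: cube_supported_partials.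
have int i j k l : mu.-integrable setT
    (EFin \o (fun x => partial i (partial j phi) x * partial k (partial l phi) x)).
  apply: cube_supported_integrable.
  exact: cube_supportedM (cc [:: i; j]) (cc [:: k; l]).1.
have sumE (h : 'I_n -> 'I_n -> 'rV[R]_n -> R) :
    (forall i j, mu.-integrable setT (EFin \o h i j)) ->
    (\int[mu]_x (\sum_i \sum_j h i j x)%:E = \sum_i \sum_j \int[mu]_x (h i j x)%:E)%E.
  move=> ih.
  transitivity (\int[mu]_x (\sum_i \sum_j (h i j x)%:E))%E.
    by apply: eq_integral => x _; rewrite -sumEFin; apply: eq_bigr => i _; rewrite -sumEFin.
  rewrite integral_sum//; last by move=> i; apply: integrable_sum => // j _; exact: ih.
  by apply: eq_bigr => i _; rewrite integral_sum// => j; exact: ih.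
apply: etrans (sumE (fun i j x => partial i (partial j phi) x ^+ 2)
  (fun i j => int i j i j)) _.
transitivity (\sum_i \sum_j \int[mu]_x
    (partial i (partial i phi) x * partial j (partial j phi) x)%:E)%E.
  apply: eq_bigr => i _; apply: eq_bigr => j _.
  have fineI (a b : \bar R) : a \is a fin_num -> b \is a fin_num ->
      fine a = fine b -> a = b.
    by move=> fa fb ab; rewrite -(fineK fa) ab fineK.
  exact: (fineI _ _ (integrable_fin_num measurableT (int i j i j))
    (integrable_fin_num measurableT (int i i j j)) (integral_hessian_entry i j sphi phi0)).
apply: etrans (esym (sumE
  (fun i j x => partial i (partial i phi) x * partial j (partial j phi) x)
  (fun i j => int i i j j))) _.
apply: eq_integral => x _; congr (_%:E).
rewrite /laplacian expr2 mulr_suml; apply: eq_bigr => i _.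
by rewrite mulr_sumr.
Qed.

(** The sum is the second derivative of [phi] in the direction [x], at [y]. *)
Lemma radial_derive2_sqr_le phi (x y : 'rV[R]_n) :
  (\sum_i \sum_j x ord0 i * x ord0 j * partial i (partial j phi) y) ^+ 2 <=
  enorm x ^+ 4 * hessian_sqr phi y.
Proof.
rewrite pair_bigA/= (le_trans (sqr_sumM_le _ _))//.
rewrite /hessian_sqr pair_bigA/= le_eqVlt; apply/orP; left; apply/eqP; congr (_ * _).
rewrite -[4%N]/(2 * 2)%N exprM enorm_sqr [RHS]expr2 mulr_suml.
rewrite (eq_bigr (fun i => \sum_j x ord0 i ^+ 2 * x ord0 j ^+ 2)); last first.
  by move=> i _; rewrite mulr_sumr.
by rewrite pair_bigA/=; apply: eq_bigr => -[i j] _ /=; rewrite exprMn.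
Qed.

End hessian.

(** * One-dimensional estimates *)

Section one_dim.
Context {R : realType}.
Local Notation leb := (@lebesgue_measure R).

Lemma integral_derivative (f df : R -> R) (a b : R) : a < b ->
  (forall t, t \in `[a, b]%R -> is_derive t 1 f (df t)) ->
  {within `[a, b], continuous df} ->
  (\int[leb]_(t in `[a, b]) (df t)%:E = (f b - f a)%:E)%E.
Proof.
move=> ab fd cdf; rewrite EFinB; apply: continuous_FTC2 => //.
  have cont t : t \in `[a, b]%R -> {for t, continuous f}.
    move=> /fd [dt _]; apply: differentiable_continuous.
    exact/derivable1_diffP.
  split.
  - by move=> t /subset_itv_oo_cc/fd [].
  - by apply/cvg_at_right_filter/cont; rewrite in_itv/= lexx ltW.
  - by apply/cvg_at_left_filter/cont; rewrite in_itv/= lexx ltW.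
by move=> t /subset_itv_oo_cc/fd [_ E]; rewrite derive1E.
Qed.

(** Optimizing [l] gives the product: with [X], [A], [B] coming from integrals this
    is how a pointwise inequality between means yields Cauchy-Schwarz. *)
Lemma sqr_le_of_amgm (X A B : R) : 0 <= X -> 0 <= A -> 0 <= B ->
  (forall l, 0 < l -> 2 * X <= l * A + l^-1 * B) -> X ^+ 2 <= A * B.
Proof.
move=> X0 A0 B0 H.
have [->|Xn0] := eqVneq X 0; first by rewrite expr0n mulr_ge0.
have Xp : 0 < X by rewrite lt_neqAle eq_sym Xn0.
have [A00|An0] := eqVneq A 0.
  have Bp : 0 < (B + 1) / X by rewrite divr_gt0// ltr_wpDl.
  have := H _ Bp; rewrite A00 mulr0 add0r invf_div mulrAC ler_pdivlMr ?ltr_wpDl//.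
  by rewrite mulrC mulrA [X in X <= _]mulrC ler_pM2l//; lra.
have Ap : 0 < A by rewrite lt_neqAle eq_sym An0.
(* the value of l minimizing the right-hand side if X ^+ 2 = A * B *)
have XA : 0 < X / A by rewrite divr_gt0.
have := H _ XA; rewrite divfK// invf_div => H1.
have H2 : X <= A / X * B by lra.
by move: H2; rewrite mulrAC ler_pdivlMr// expr2.
Qed.

(** A bound for the integral of [s ^ (N - 3)] over the interval from [1] to [r],
    divided by [r ^ (N - 2)]: a logarithm appears in the plane only. *)
Definition radial_factor (N : nat) (r : R) : R := if N == 2%N then ln r else 1.

Lemma radial_factor_ge0 N r : 1 <= r -> 0 <= radial_factor N r.
Proof. by rewrite /radial_factor; case: ifP => // _; exact: ln_ge0. Qed.

Lemma continuous_expn_div_cube (N : nat) (r : R) :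
  {within `[1, r], continuous (fun s : R => s ^+ N / s ^+ 3)}.
Proof.
apply: continuous_in_subspaceT => s; rewrite inE/= in_itv/= => /andP[s1 _].
have s0 : s != 0 by rewrite gt_eqF// (lt_le_trans ltr01).
apply: cvgM; first exact: exprn_continuous.
by apply: cvgV; [rewrite expf_neq0|exact: exprn_continuous].
Qed.

(** The power [s ^ (N - 3)] is written as a quotient because its exponent is
    negative for [N = 2], where its integral is [ln r]; for [N >= 3] it is at most
    [r ^ (N - 3)] on the interval. *)
Lemma integral_radial_factor (N : nat) (r : R) : (2 <= N)%N -> 1 < r ->
  (\int[leb]_(s in `[1%R, r]) (s ^+ N / s ^+ 3)%:E <=
   (r ^+ N / r ^+ 2 * radial_factor N r)%:E)%E.
Proof.
move=> N2 r1; have r0 : 0 < r by exact: lt_trans r1.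
rewrite /radial_factor; case: eqVneq => [->|Nn2].
  rewrite divff ?mul1r ?expf_neq0 ?gt_eqF//.
  have dln t : t \in `[1%R, r]%R -> is_derive t 1 (@ln R) (t ^+ 2 / t ^+ 3).
    rewrite in_itv/= => /andP[t1 _]; have t0 : 0 < t by exact: lt_le_trans t1.
    rewrite (_ : _ / _ = t^-1); first exact: is_derive1_ln.
    by field; rewrite gt_eqF.
  by rewrite (integral_derivative r1 dln (@continuous_expn_div_cube 2 r)) ln1 subr0.
have N3 : (3 <= N)%N by rewrite ltn_neqAle eq_sym Nn2.
apply: (@le_trans _ _ (\int[leb]_(s in `[1%R, r]) (cst (r ^+ N / r ^+ 3)%:E s))%E).
  apply: ge0_le_integral => //.
  - move=> s; rewrite /= in_itv/= => /andP[s1 _]; rewrite lee_fin.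
    by rewrite divr_ge0// exprn_ge0// (le_trans ler01).
  - apply/measurable_EFinP; apply: subspace_continuous_measurable_fun => //.
    exact: continuous_expn_div_cube.
  - move=> s; rewrite /= in_itv/= => /andP[s1 sr]; rewrite lee_fin.
    have s0 : 0 < s by exact: lt_le_trans s1.
    rewrite -(subnK N3) !exprD !mulfK ?expf_neq0 ?gt_eqF//.
    by rewrite lerXn2r// ?nnegrE ltW.
have mI : leb `[1%R, r]%classic = (r - 1)%:E.
  by rewrite lebesgue_measure_itv/= lte_fin r1 -EFinD.
rewrite integral_cst//.
apply: (@le_trans _ _ ((r ^+ N / r ^+ 3)%:E * leb `[1%R, r]%classic)%E) => //.
rewrite mI -EFinM lee_fin.
rewrite mulr1 exprSr invfM mulrA -[leRHS]mulr1 -!mulrA ler_wpM2l ?exprn_ge0 ?(ltW r0)//.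
rewrite ler_wpM2l// ?invr_ge0 ?exprn_ge0 ?(ltW r0)//.
by rewrite mulrC ler_pdivrMr// mul1r lerBlDr lerDl.
Qed.

End one_dim.

(** * Growth along a ray *)

Section ray.
Context {R : realType} {N : nat}.
Implicit Types (phi : 'rV[R]_N -> R) (x : 'rV[R]_N).
Local Notation leb := (@lebesgue_measure R).

Lemma hessian_sqr_ge0 phi x : 0 <= hessian_sqr phi x.
Proof. by apply: sumr_ge0 => i _; apply: sumr_ge0 => j _; exact: sqr_ge0. Qed.

Lemma hessian_sqr_continuous phi : smooth phi -> continuous (hessian_sqr phi).
Proof.
move=> sphi; apply: continuous_sumr => i; apply: continuous_sumr => j x.
apply: (@continuous_comp _ _ _ (partial i (partial j phi)) (fun z => z ^+ 2)).
  exact: (sphi [:: i; j]).1.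
exact: exprn_continuous.
Qed.

Lemma hessian_sqr_eq0_outside (S : set 'rV[R]_N) phi : closed S ->
  (forall x, ~ S x -> phi x = 0) -> forall x, ~ S x -> hessian_sqr phi x = 0.
Proof.
move=> cS p0 x nS; rewrite /hessian_sqr big1// => i _; rewrite big1// => j _.
by rewrite (partial_eq0_outside i cS (partial_eq0_outside j cS p0)) ?expr0n.
Qed.

(** Let [P t] and [Q t] be the first and second derivatives of [t |-> phi (t x)],
    which vanish for [0 <= t <= 1 / r].  The mean value theorem bounds [phi x] by some
    [P (1 / tau)], and [s |-> P (1 / s)], which vanishes at [r], is the integral of its
    derivative [- s ^ -2 Q (1 / s)].  The latter is at most
    [r ^ 2 s ^ -2 (hessian_sqr phi (x / s)) ^ (1/2)], and [s ^ -2] is split as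
    [s ^ ((N - 3) / 2) s ^ (- (N + 1) / 2)] before the Cauchy-Schwarz inequality.
    Points of the ray are written [x / s] rather than [t x] so that the substitutions
    made later are linear in [s]. *)
Lemma ray_estimate (S : set 'rV[R]_N) phi x : (2 <= N)%N -> smooth phi ->
  closed S -> S `<=` [set y | 1 < enorm y] -> (forall y, ~ S y -> phi y = 0) ->
  1 < enorm x ->
  ((phi x ^+ 2)%:E <= (enorm x ^+ N.+2 * radial_factor N (enorm x))%:E *
    \int[leb]_(s in `[1%R, enorm x]) (s ^- N.+1 * hessian_sqr phi (s^-1 *: x))%:E)%E.
Proof.
move=> N2 sphi cS S1 phi0; set r := enorm x => r1.
have r0 : 0 < r by exact: lt_trans r1.
have c s : continuous (partials s phi) by case: (sphi s).
have d s k y : derivable (partials s phi) y (delta_mx ord0 k) by case: (sphi s).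
have out y : enorm y <= 1 -> ~ S y.
  by move=> y1 /S1/=; rewrite ltNge y1.
pose P t := \sum_i x ord0 i * partial i phi (t *: x).
pose Q t := \sum_i \sum_j x ord0 i * x ord0 j * partial i (partial j phi) (t *: x).
have dphi (t : R) : is_derive t 1 (fun s => phi (s *: x)) (P t).
  by apply: is_derive_ray; [move=> i y; exact: (d [::] i y)|move=> i; exact: (c [:: i])].
have dP (t : R) : is_derive t 1 P (Q t).
  have H i : is_derive t 1 (fun s => x ord0 i * partial i phi (s *: x))
     (x ord0 i * \sum_j x ord0 j * partial j (partial i phi) (t *: x)).
    have Hi := is_derive_ray x t (d [:: i]) (fun j => c [:: j; i]).
    exact: (is_deriveZ (x ord0 i) Hi).
  have -> : P = \sum_(i < N) (fun s => x ord0 i * partial i phi (s *: x)).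
    by apply/funext => s; rewrite fct_sumE.
  rewrite (_ : Q t =
      \sum_i x ord0 i * \sum_j x ord0 j * partial j (partial i phi) (t *: x)).
    exact: is_derive_sum.
  rewrite /Q exchange_big; apply: eq_bigr => i _; rewrite mulr_sumr.
  by apply: eq_bigr => j _; rewrite mulrCA mulrA.
have P0 (t : R) : 0 <= t -> t * r <= 1 -> P t = 0.
  move=> t0 tr; rewrite /P big1// => i _; rewrite (partial_eq0_outside i cS phi0) ?mulr0//.
  by apply: out; rewrite enormZ.
have cQ : continuous Q.
  have cx (F : 'rV[R]_N -> R) : continuous F -> continuous (fun t : R => F (t *: x)).
    move=> cF t; apply: (@continuous_comp _ _ _ (fun t : R => t *: x) F); last exact: cF.
    exact: scalel_continuous.
  apply: continuous_sumr => i; apply: continuous_sumr => j t.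
  by apply: cvgM; [exact: cvg_cst|exact: (cx _ (c [:: i; j]))].
have [tau [t1 tr phiP]] : exists tau, [/\ 1 <= tau, tau < r & `|phi x| <= `|P tau^-1|].
  have cphi : {within `[0, 1], continuous (fun s : R => phi (s *: x))}.
    apply: derivable_within_continuous => t _.
    exact: (@ex_derive _ _ _ _ _ _ _ (dphi t)).
  have [xi] := MVT ltr01 (fun t _ => dphi t) cphi.
  rewrite in_itv/= scale1r scale0r subr0 mulr1 (phi0 0) ?subr0; last first.
    by apply: out; rewrite -(scale0r x) enormZ// mul0r.
  move=> /andP[xi0 xi1] ->.
  have [xr|xr] := leP (xi * r) 1.
    (* here P xi vanishes, hence so does phi x, and any tau will do *)
    by exists 1; split => //; rewrite P0 ?(ltW xi0)// normr0.
  exists xi^-1; rewrite invrK; split => //.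
    by rewrite invf_ge1// ltW.
  by rewrite -[xi^-1]mul1r ltr_pdivrMr// mulrC.
pose a (s : R) := s ^+ N / s ^+ 3.
pose b (s : R) := s ^- N.+1 * hessian_sqr phi (s^-1 *: x).
pose f (s : R) := P s^-1.
pose df (s : R) := - (s ^- 2 * Q s^-1).
have inI (s : R) : s \in `[1, r]%R -> 0 < s.
  by rewrite in_itv/= => /andP[s1 _]; exact: lt_le_trans s1.
have dfP (s : R) : 0 < s -> is_derive s 1 f (df s).
  move=> s0.
  have dV : is_derive s 1 (fun y : R => y^-1) (- s ^- 2 *: (1 : R)).
    by apply: (@is_deriveV _ id) => //; rewrite gt_eqF.
  have := is_derive1_comp (dP s^-1) dV.
  by rewrite /df [_%:A]mulr1 mulrN mulrC.
have cV (s : R) : 0 < s -> {for s, continuous (fun s : R => s^-1)}.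
  by move=> s0; apply: inv_continuous; rewrite gt_eqF.
have cVn (s : R) n : 0 < s -> {for s, continuous (fun s : R => s ^- n)}.
  move=> s0; apply: cvgV; first by rewrite expf_neq0// gt_eqF.
  exact: exprn_continuous.
have cdf (s : R) : 0 < s -> {for s, continuous df}.
  move=> s0; apply: cvgN; apply: cvgM; first exact: cVn.
  by apply: (@continuous_comp _ _ _ (fun s : R => s^-1) Q); [exact: cV|exact: cQ].
have cb (s : R) : 0 < s -> {for s, continuous b}.
  move=> s0; apply: cvgM; first exact: cVn.
  apply: (@continuous_comp _ _ _ (fun s : R => s^-1 *: x) (hessian_sqr phi));
    last exact: hessian_sqr_continuous.
  apply: (@continuous_comp _ _ _ (fun s : R => s^-1) (fun t => t *: x)); first exact: cV.
  exact: scalel_continuous.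
have within_cont (h : R -> R) (u : R) : 1 <= u ->
    (forall s : R, 0 < s -> {for s, continuous h}) ->
    {within `[u, r], continuous h}.
  move=> u1 ch; apply: continuous_in_subspaceT => s; rewrite inE/= in_itv/= => /andP[us _].
  by apply: ch; rewrite (lt_le_trans ltr01)// (le_trans u1).
have intble (h : R -> R) (u : R) : 1 <= u -> {within `[u, r], continuous h} ->
    leb.-integrable `[u, r] (EFin \o h).
  by move=> u1 ch; apply: continuous_compact_integrable => //; exact: segment_compact.
have ia : leb.-integrable `[1, r] (EFin \o a).
  by apply: intble => //; exact: continuous_expn_div_cube.
have ib : leb.-integrable `[1, r] (EFin \o b).
  by apply: intble => //; exact: within_cont.
have a0 (s : R) : 0 < s -> 0 <= a s by move=> s0; rewrite divr_ge0// exprn_ge0// ltW.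
have b0 (s : R) : 0 < s -> 0 <= b s.
  by move=> s0; rewrite mulr_ge0// ?hessian_sqr_ge0// invr_ge0 exprn_ge0// ltW.
pose A := fine (\int[leb]_(s in `[1%R, r]) (a s)%:E)%E.
pose B := fine (\int[leb]_(s in `[1%R, r]) (b s)%:E)%E.
have AE : (\int[leb]_(s in `[1%R, r]) (a s)%:E = A%:E)%E.
  by rewrite fineK//; exact: integrable_fin_num ia.
have BE : (\int[leb]_(s in `[1%R, r]) (b s)%:E = B%:E)%E.
  by rewrite fineK//; exact: integrable_fin_num ib.
have A0 : 0 <= A by apply: fine_ge0; apply: integral_ge0 => s /inI s0; rewrite lee_fin a0.
have B0 : 0 <= B by apply: fine_ge0; apply: integral_ge0 => s /inI s0; rewrite lee_fin b0.
(* inequality between means with a parameter l, which is optimized at the end *)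
have df_le (l s : R) : 0 < l -> 0 < s ->
    2 * `|df s| <= l * r ^+ 2 * a s + l^-1 * r ^+ 2 * b s.
  move=> l0 s0.
  have u0 : 0 <= l * r ^+ 2 * a s by rewrite mulr_ge0 ?a0// mulr_ge0 ?sqr_ge0// ltW.
  have v0 : 0 <= l^-1 * r ^+ 2 * b s.
    by rewrite mulr_ge0 ?b0// mulr_ge0 ?sqr_ge0// invr_ge0 ltW.
  have d0 : 0 <= 2 * `|df s| by rewrite mulr_ge0.
  rewrite -(@ler_pXn2r _ 2)//; last by rewrite nnegrE addr_ge0.
  apply: (@le_trans _ _ (4 * (l * r ^+ 2 * a s) * (l^-1 * r ^+ 2 * b s))); last first.
    rewrite -subr_ge0.
    rewrite (_ : _ - _ = (l * r ^+ 2 * a s - l^-1 * r ^+ 2 * b s) ^+ 2) ?sqr_ge0//.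
    by ring.
  rewrite exprMn real_normK ?num_real// /df sqrrN exprMn.
  have HQ := radial_derive2_sqr_le phi x (s^-1 *: x).
  have -> : 4 * (l * r ^+ 2 * a s) * (l^-1 * r ^+ 2 * b s) =
     2 ^+ 2 * ((s ^- 2) ^+ 2 * (r ^+ 4 * hessian_sqr phi (s^-1 *: x))).
    rewrite /a /b [s ^+ N.+1]exprS; field.
    by rewrite !gt_eqF// exprn_gt0.
  by rewrite ler_wpM2l// ler_wpM2l// sqr_ge0.
have key (l : R) : 0 < l -> 2 * `|phi x| <= l * (r ^+ 2 * A) + l^-1 * (r ^+ 2 * B).
  move=> l0.
  apply: (@le_trans _ _ (2 * `|f tau|)); first by rewrite ler_pM2l.
  have E1 : (\int[leb]_(s in `[tau, r]) (df s)%:E = (- f tau)%:E)%E.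
    have dft t : t \in `[tau, r]%R -> is_derive t 1 f (df t).
      rewrite in_itv/= => /andP[tt _]; apply: dfP.
      by rewrite (lt_le_trans ltr01)// (le_trans t1).
    rewrite (integral_derivative tr dft (within_cont _ _ t1 cdf)).
    by rewrite [f r]P0 ?sub0r ?mulVf ?gt_eqF// invr_ge0 ltW.
  have mdf : measurable_fun `[tau, r] (EFin \o df).
    apply/measurable_EFinP; apply: subspace_continuous_measurable_fun => //.
    exact: within_cont.
  have Zl (k : R) (h : R -> R) : leb.-integrable `[1, r] (EFin \o h) ->
      (\int[leb]_(s in `[1%R, r]) (k * h s)%:E =
       k%:E * \int[leb]_(s in `[1%R, r]) (h s)%:E)%E.
    by move=> ih; under eq_integral do rewrite EFinM; rewrite integralZl.
  have iZ (k : R) (h : R -> R) : leb.-integrable `[1, r] (EFin \o h) ->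
      leb.-integrable `[1, r] (EFin \o (fun s => k * h s)).
    by move=> ih; exact: (@integrableZl _ _ _ leb _ (measurable_itv `[1, r]) k _ ih).
  have iZa := iZ (l * r ^+ 2) _ ia; have iZb := iZ (l^-1 * r ^+ 2) _ ib.
  have ig : leb.-integrable `[1, r]
      (EFin \o (fun s => l * r ^+ 2 * a s + l^-1 * r ^+ 2 * b s)).
    exact: (@integrableD _ _ _ leb _ (measurable_itv `[1, r]) _ _ iZa iZb).
  rewrite -lee_fin.
  have -> : ((l * (r ^+ 2 * A) + l^-1 * (r ^+ 2 * B))%:E =
      \int[leb]_(s in `[1%R, r]) (l * r ^+ 2 * a s + l^-1 * r ^+ 2 * b s)%:E)%E.
    by rewrite integralD_EFin//= !Zl// AE BE -!EFinM -EFinD !mulrA.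
  have sub : `[tau, r]%classic `<=` `[1%R, r]%classic.
    by move=> s; rewrite /= !in_itv/= => /andP[ts ->]; rewrite (le_trans t1).
  have mg := measurable_int leb ig.
  rewrite EFinM -normrN -[(`|_|)%:E]/(`|(- f tau)%:E|)%E -E1.
  apply: (@le_trans _ _ (2%:E * \int[leb]_(s in `[tau, r]) `|(df s)%:E|)%E).
    by rewrite lee_wpmul2l//; apply: le_abse_integral.
  rewrite -ge0_integralZl//; last exact: measurableT_comp.
  apply: (@le_trans _ _ (\int[leb]_(s in `[tau, r])
      (l * r ^+ 2 * a s + l^-1 * r ^+ 2 * b s)%:E)%E).
    apply: ge0_le_integral => //.
    - by apply: measurable_funeM; exact: measurableT_comp.
    - exact: (measurable_funS _ sub mg).
    - move=> s st; rewrite -EFinM lee_fin; apply: df_le => //.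
      by apply: inI; exact: sub.
  apply: ge0_subset_integral => //= s /inI s0; rewrite lee_fin.
  apply: le_trans (df_le _ _ l0 s0); exact: mulr_ge0.
have r20 : 0 <= r ^+ 2 by rewrite sqr_ge0.
have := sqr_le_of_amgm (normr_ge0 _) (mulr_ge0 r20 A0) (mulr_ge0 r20 B0) key.
rewrite real_normK ?num_real// => H.
rewrite -/b BE -EFinM lee_fin (le_trans H)//.
have AK : A <= r ^+ N / r ^+ 2 * radial_factor N r.
  by rewrite -lee_fin -AE integral_radial_factor.
have E1 : r ^+ 2 * A * (r ^+ 2 * B) = r ^+ 2 * r ^+ 2 * A * B by ring.
have E2 : r ^+ N.+2 * radial_factor N r * B =
    r ^+ 2 * r ^+ 2 * (r ^+ N / r ^+ 2 * radial_factor N r) * B.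
  by rewrite [r ^+ N.+2]exprS [r ^+ N.+1]exprS; field; rewrite gt_eqF.
by rewrite E1 E2 ler_wpM2r// ler_wpM2l// mulr_ge0.
Qed.
End ray.

(** * The weighted inequality for test functions *)

Lemma measurable_fun_inv (R : realType) :
  measurable_fun [set: R] (@GRing.inv R).
Proof.
rewrite -(setUv [set (0 : R)]); apply/measurable_funU => //.
  by apply: measurableC.
split; first exact: measurable_fun_set1.
apply: open_continuous_measurable_fun.
  by apply: closed_openC; exact: closed_eq.
by move=> x; rewrite inE/= => x0; apply: inv_continuous; exact/eqP.
Qed.

Section weighted.
Context {R : realType} {N : nat}.
Local Notation leb := (@lebesgue_measure R).
Local Notation mu := (lebesgue_rV N).
Local Open Scope ereal_scope.

Lemma measurable_radial_factor : measurable_fun setT (@radial_factor R N).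
Proof.
rewrite /radial_factor; case: (N == 2%N); last exact: measurable_cst.
exact: measurable_ln.
Qed.

(** [step1] integrates [ray_estimate] against the weight; [step2] is the dilation
    [x = s y] for fixed [s], the Jacobian [s ^ N] of which leaves [s ^ -1] of the factor
    [s ^ (- N - 1)]; [step3] is the dilation [r = s |y|] for fixed [y].  The values of
    [W] on [r <= 1] are zero because the ray estimate starts at the unit sphere. *)
Lemma weighted_estimate (S : set 'rV[R]_N) (phi : 'rV[R]_N -> R) (W : R -> \bar R) :
  (2 <= N)%N -> smooth phi -> closed S -> S `<=` [set y | (1 < enorm y)%R] ->
  (forall y, ~ S y -> phi y = 0%R) ->
  measurable_fun setT W -> (forall r, 0 <= W r) -> (forall r, (r <= 1)%R -> W r = 0) ->
  \int[mu]_x (W (enorm x) * (phi x ^+ 2)%:E) <=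
  \int[leb]_r (W r * (r ^+ N.+1 * radial_factor N r)%:E) *
  \int[mu]_x (hessian_sqr phi x)%:E.
Proof.
move=> N2 sphi cS S1 phi0 mW W0 W1.
pose w (k : nat) r := W r * (r ^+ k * radial_factor N r)%:E.
have mw k : measurable_fun setT (w k).
  apply: emeasurable_funM => //; apply/measurable_EFinP; apply: measurable_funM => //.
  exact: measurable_radial_factor.
have w0 k r : 0 <= w k r.
  have [r1|r1] := leP r 1%R; first by rewrite /w W1// mul0e.
  rewrite mule_ge0// lee_fin mulr_ge0 ?radial_factor_ge0// ?exprn_ge0// ltW//.
  exact: lt_trans r1.
pose H := hessian_sqr phi.
have H0 x : (0 <= H x)%R by exact: hessian_sqr_ge0.
have mH : measurable_fun setT H by apply: continuous_measurable_rV; exact: hessian_sqr_continuous.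
have men := @measurable_enorm R N.
pose one (s : R) : R := \1_`[1%R, +oo[%classic s.
have mone : measurable_fun setT one by exact: measurable_indic.
have one0 s : (0 <= one s)%R by rewrite /one indicE.
have minv := @measurable_fun_inv R.
(* the integrands before and after the dilation x = s y, with z = (x, s) *)
pose F (z : 'rV[R]_N * R) :=
  w N.+2 (enorm z.1) * (one z.2 * (z.2 ^- N.+1 * H (z.2^-1 *: z.1)))%:E.
pose G (z : 'rV[R]_N * R) :=
  (one z.2 * z.2^-1)%:E * w N.+2 (z.2 * enorm z.1)%R * (H z.1)%:E.
have ms2 : measurable_fun [set: 'rV[R]_N * R] (fun z : 'rV[R]_N * R => one z.2).
  exact: (measurableT_comp mone measurable_snd).
have mi2 : measurable_fun [set: 'rV[R]_N * R] (fun z : 'rV[R]_N * R => z.2^-1)%R.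
  exact: (measurableT_comp minv measurable_snd).
have me1 : measurable_fun [set: 'rV[R]_N * R] (fun z : 'rV[R]_N * R => enorm z.1).
  exact: (measurableT_comp men measurable_fst).
have mF : measurable_fun setT F.
  apply: emeasurable_funM.
    exact: (measurableT_comp (mw N.+2) me1).
  apply/measurable_EFinP; apply: measurable_funM => //; apply: measurable_funM.
    under eq_fun do rewrite -exprVn.
    exact: measurable_funX.
  apply: (measurableT_comp mH); apply: measurable_fun_rV => i.
  under eq_fun do rewrite mxE.
  apply: measurable_funM => //.
  exact: (measurableT_comp (measurable_rV_coord i) measurable_fst).
have mG : measurable_fun setT G.
  apply: emeasurable_funM; last first.
    by apply/measurable_EFinP; exact: (measurableT_comp mH measurable_fst).
  apply: emeasurable_funM.
    by apply/measurable_EFinP; apply: measurable_funM.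
  apply: (measurableT_comp (mw N.+2)).
  by apply: measurable_funM => //; exact: measurable_snd.
have s0 (s : R) : one s != 0%R -> (1 <= s)%R.
  rewrite /one indicE; case: (boolP (s \in _)); last by rewrite eqxx.
  by rewrite inE/= in_itv/= andbT.
have F0 z : 0 <= F z.
  apply: mule_ge0 => //; rewrite lee_fin.
  have [->|/s0 z1] := eqVneq (one z.2) 0%R; first by rewrite mul0r.
  by rewrite !mulr_ge0// invr_ge0 exprn_ge0// (le_trans ler01).
have G0 z : 0 <= G z.
  apply: mule_ge0; rewrite ?lee_fin//; apply: mule_ge0 => //; rewrite lee_fin.
  have [->|/s0 z1] := eqVneq (one z.2) 0%R; first by rewrite mul0r.
  by rewrite mulr_ge0// invr_ge0 (le_trans ler01).
have TF := @fubini_tonelli _ _ _ _ _ mu leb F mF F0.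
have TG := @fubini_tonelli _ _ _ _ _ mu leb G mG G0.
have step1 : \int[mu]_x (W (enorm x) * (phi x ^+ 2)%:E) <= \int[mu]_x \int[leb]_s F (x, s).
  apply: ge0_le_integral => //.
  - by move=> x _; apply: mule_ge0 => //; rewrite lee_fin sqr_ge0.
  - apply: emeasurable_funM; first exact: (measurableT_comp mW men).
    apply/measurable_EFinP; apply: measurable_funX.
    by apply: continuous_measurable_rV; exact: (sphi [::]).1.
  - by exact: (measurable_fun_fubini_tonelli_F (m2 := leb) F mF F0).
  move=> x _; have [x1|x1] := leP (enorm x) 1%R.
    by rewrite W1// mul0e integral_ge0.
  have k0 s : 0 <= (one s * (s ^- N.+1 * H (s^-1 *: x)))%:E.
    rewrite lee_fin; have [->|/s0 z1] := eqVneq (one s) 0%R; first by rewrite mul0r.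
    by rewrite !mulr_ge0// invr_ge0 exprn_ge0// (le_trans ler01).
  have mk : measurable_fun setT (fun s : R => (one s * (s ^- N.+1 * H (s^-1 *: x)))%:E).
    apply/measurable_EFinP; apply: measurable_funM => //; apply: measurable_funM.
      by under eq_fun do rewrite -exprVn; exact: measurable_funX.
    apply: (measurableT_comp mH); apply: measurable_fun_rV => i.
    under eq_fun do rewrite mxE.
    exact: measurable_funM.
  rewrite /F /= ge0_integralZl// /w -muleA lee_wpmul2l//.
  apply: le_trans (ray_estimate N2 sphi cS S1 phi0 x1) _.
  apply: lee_wpmul2l.
    by rewrite lee_fin mulr_ge0 ?radial_factor_ge0 ?(ltW x1)// exprn_ge0// enorm_ge0.
  apply: (@le_trans _ _ (\int[leb]_(s in `[1%R, enorm x])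
      (one s * (s ^- N.+1 * H (s^-1 *: x)))%:E)).
    rewrite le_eqVlt; apply/orP; left; apply/eqP; apply: eq_integral => s.
    rewrite inE/= in_itv/= => /andP[s1 _].
    by rewrite /one indicE mem_set ?mul1r//= in_itv/= s1.
  exact: ge0_subset_integral.
have step2 s : \int[mu]_x F (x, s) = \int[mu]_x G (x, s).
  have [os|os] := eqVneq (one s) 0%R.
    by apply: eq_integral => x _; rewrite /F /G/= os !mul0r mule0 !mul0e.
  have s1 := s0 _ os; have sp : (0 < s)%R by exact: lt_le_trans s1.
  have mFs : measurable_fun setT (fun x => F (x, s)).
    exact: (measurableT_comp mF (measurable_pair2 s)).
  have E0 := ge0_integral_rV_affine 0%R sp mFs (fun x => F0 _).
  have sN0 : 0 <= (s ^+ N)%:E by rewrite lee_fin exprn_ge0// ltW.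
  have mFa : measurable_fun setT (fun x : 'rV[R]_N => F ((s *: x + 0)%R, s)).
    apply: (measurableT_comp (f := fun x : 'rV[R]_N => F (x, s)) mFs).
    exact: measurable_rV_affine.
  have E1 : \int[mu]_x F (x, s) = \int[mu]_x ((s ^+ N)%:E * F ((s *: x + 0)%R, s)).
    have E2 := @ge0_integralZl _ _ _ mu setT measurableT _ mFa _ (fun x _ => F0 _) sN0.
    have mulK (I J : \bar R) : J = (s ^- N)%:E * I -> I = (s ^+ N)%:E * J.
      by move=> ->; rewrite muleA -EFinM divff ?mul1e// expf_neq0// gt_eqF.
    exact: etrans (mulK _ _ E0) (esym E2).
  rewrite E1.
  apply: eq_integral => x _; rewrite /F /G/= addr0 enormZ ?(ltW sp)//.
  rewrite scalerA mulVf ?gt_eqF// scale1r muleCA [X in _ = X * _]muleC -[RHS]muleA.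
  congr (_ * _); rewrite -!EFinM; congr (_%:E).
  by rewrite exprS; field; rewrite !gt_eqF// exprn_gt0.
have step3 x : \int[leb]_s G (x, s) <= (\int[leb]_r w N.+1 r) * (H x)%:E.
  have [Hx|Hx] := eqVneq (H x) 0%R.
    rewrite Hx mule0; under eq_integral do rewrite /G/= Hx mule0.
    by rewrite integral0.
  have x1 : (1 < enorm x)%R.
    apply: S1; apply: contrapT => nS; move/eqP: Hx; apply.
    exact: (hessian_sqr_eq0_outside cS phi0).
  have x0 : (0 < enorm x)%R by exact: lt_trans x1.
  have mwx : measurable_fun setT (fun s : R => w N.+1 (enorm x * s)%R).
    by apply: (measurableT_comp (mw N.+1)); apply: measurable_funM.
  apply: (@le_trans _ _ (\int[leb]_s ((enorm x * H x)%:E * w N.+1 (enorm x * s)%R))).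
    apply: ge0_le_integral; first exact: measurableT.
    - by move=> s _; exact: G0.
    - exact: (measurableT_comp mG (measurable_pair1 x)).
    - exact: measurable_funeM.
    - move=> s _; have [os|os] := eqVneq (one s) 0%R.
        by rewrite /G/= os mul0r !mul0e mule_ge0// lee_fin mulr_ge0// ltW.
      have s1 := s0 _ os; have sp : (0 < s)%R by exact: lt_le_trans s1.
      have o1 : one s = 1%R.
        by move: os; rewrite /one indicE; case: (_ \in _); rewrite ?eqxx.
      rewrite /G/= o1 mul1r muleAC -EFinM.
      have -> : w N.+2 (s * enorm x)%R = w N.+1 (enorm x * s)%R * (enorm x * s)%:E.
        rewrite /w -muleA -EFinM [(s * _)%R]mulrC; congr (_ * _%:E).
        by rewrite [X in (X * _)%R = _]exprS; ring.
      rewrite [leRHS]muleC muleCA -EFinM le_eqVlt; apply/orP; left; apply/eqP.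
      by congr (_ * _%:E); field; rewrite gt_eqF.
  rewrite ge0_integralZl//; last by rewrite lee_fin mulr_ge0// ltW.
  have E0 := @ge0_integral_affine R (enorm x) 0%R (w N.+1) x0 (mw _) (w0 _).
  have -> : \int[leb]_s w N.+1 (enorm x * s)%R = (enorm x)^-1%:E * \int[leb]_s w N.+1 s.
    by rewrite -E0; apply: eq_integral => s _; rewrite addr0.
  by rewrite muleA -EFinM mulrAC divff ?gt_eqF// mul1r muleC.
apply: (le_trans step1); rewrite TF.
under eq_integral do rewrite step2.
rewrite -TG.
have mHE : measurable_fun setT (fun x => (H x)%:E) by exact/measurable_EFinP.
have c0 : 0 <= \int[leb]_r w N.+1 r by exact: integral_ge0.
have E3 := @ge0_integralZl _ _ _ mu setT measurableT _ mHE _ (fun x _ => H0 x) c0.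
apply: le_trans (_ : _ <= \int[mu]_x ((\int[leb]_r w N.+1 r) * (H x)%:E)) _;
  last by rewrite E3.
apply: ge0_le_integral; first exact: measurableT.
- by move=> x _; exact: integral_ge0.
- exact: (measurable_fun_fubini_tonelli_F (m2 := leb) G mG G0).
- exact: measurable_funeM.
- by move=> x _; exact: step3.
Qed.

End weighted.

(** * Integrals of non-measurable functions and almost everywhere convergence *)

Section integral_nonmeasurable.
Context d (T : measurableType d) (R : realType) (mu : {measure set T -> \bar R}).
Local Open Scope ereal_scope.
Implicit Types (D Z : set T) (f g : T -> \bar R).

(** The integral of a nonnegative function is a supremum over the simple functions
    below it, hence monotone for arbitrary functions. *)
Lemma ge0_le_integral_any D f g : (forall x, D x -> 0 <= f x) ->
  (forall x, D x -> f x <= g x) -> \int[mu]_(x in D) f x <= \int[mu]_(x in D) g x.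
Proof.
move=> f0 fg; have g0 x : D x -> 0 <= g x by move=> Dx; exact: le_trans (f0 _ Dx) (fg _ Dx).
rewrite !ge0_integralE//; apply: le_ereal_sup => _ [h /= hf <-]; exists h => //.
move=> x; apply: le_trans (hf x) _; rewrite !patchE; case: ifPn => // /set_mem.
exact: fg.
Qed.

(** Removing a null set does not change the integral of the measurable [f] and can
    only decrease that of [g]. *)
Lemma measurable_le_integral_ae D Z f g : measurable D -> measurable Z -> mu Z = 0 ->
  measurable_fun D f -> (forall x, D x -> 0 <= f x) -> (forall x, D x -> 0 <= g x) ->
  (forall x, D x -> ~ Z x -> f x <= g x) ->
  \int[mu]_(x in D) f x <= \int[mu]_(x in D) g x.
Proof.
move=> mD mZ Z0 mf f0 g0 fg.
rewrite (ge0_negligible_integral mZ mD mf f0 Z0) integral_mkcond [leRHS]integral_mkcond.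
apply: ge0_le_integral_any => x _.
  by apply: erestrict_ge0 => y [Dy _]; exact: f0.
rewrite !patchE; case: ifPn => [/set_mem[Dx Zx]|_].
  by rewrite mem_set//; exact: fg.
by case: ifPn => // /set_mem; exact: g0.
Qed.

(** Raising the measurable [g] to infinity on a null set does not change its
    integral and makes the inequality hold everywhere. *)
Lemma le_measurable_integral_ae D Z f g : measurable D -> measurable Z -> mu Z = 0 ->
  measurable_fun D g -> (forall x, D x -> 0 <= f x) -> (forall x, D x -> 0 <= g x) ->
  (forall x, D x -> ~ Z x -> f x <= g x) ->
  \int[mu]_(x in D) f x <= \int[mu]_(x in D) g x.
Proof.
move=> mD mZ Z0 mg f0 g0 fg.
pose k := (cst +oo : T -> \bar R) \_ Z.
have k0 x : 0 <= k x by rewrite /k patchE; case: ifP => //= _; exact: leey.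
have mk : measurable_fun D k.
  apply: measurable_funTS.
  by apply/(measurable_restrictT _ _).1 => //; exact: measurable_cst.
apply: (@le_trans _ _ (\int[mu]_(x in D) (g x + k x))).
  apply: ge0_le_integral_any => // x Dx.
  have [Zx|/(fg _ Dx) fgx] := pselect (Z x).
    rewrite [k x]patchE mem_set//= addey ?leey//.
    by rewrite -ltNye (lt_le_trans _ (g0 _ Dx)).
  exact: le_trans fgx (leeDl _ (k0 x)).
rewrite le_eqVlt; apply/orP; left; apply/eqP; apply: ge0_ae_eq_integral => //.
- exact: emeasurable_funD.
- by move=> x Dx; apply: adde_ge0 => //; exact: g0.
exists Z; split => // x /=; apply: contra_notP => Zx Dx.
by rewrite /k patchE memNset// adde0.
Qed.

End integral_nonmeasurable.

Section subsequence.
Context d (T : measurableType d) (R : realType) (mu : {measure set T -> \bar R}).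
Local Open Scope ereal_scope.

Lemma cvg0_of_nneseries (t : nat -> R) : (forall j, (0 <= t j)%R) ->
  \sum_(j <oo) (t j)%:E < +oo -> t @ \oo --> 0%R.
Proof.
move=> t0 tfin.
have tail := nneseries_tail_cvg (P := xpredT) tfin (fun k _ => t0 k).
have : (fun j => (t j)%:E) @ \oo --> 0%E.
  apply: (@squeeze_cvge _ _ _ _ (fun=> 0) _ (fun N => \sum_(N <= k <oo) (t k)%:E)) tail.
    apply: nearW => j; rewrite lee_fin t0/=.
    have := @nneseries_lim_ge R (fun j => (t j)%:E) xpredT j j.+1 (fun n _ _ => t0 n).
    by rewrite big_nat1.
  exact: cvg_cst.
by move=> /fine_cvgP[_].
Qed.

(** The indices [sigma j] are chosen so that the integrals over [K j] are at most
    [2 ^ (- j - 1)].  Their sum is finite, so the series of the integrands converges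
    almost everywhere and its terms tend to zero; every point of [D] lies in [K j]
    for large [j]. *)
Lemma L1loc_ae_subsequence (D : set T) (K : nat -> set T)
    (f_ : nat -> T -> R) (f : T -> R) :
  measurable D -> (forall j, measurable (K j)) -> (forall j, K j `<=` D) ->
  (forall x, D x -> \forall j \near \oo, K j x) ->
  (forall k, measurable_fun D (f_ k)) -> measurable_fun D f ->
  (forall j, \int[mu]_(x in K j) `|f_ k x - f x|%:E @[k --> \oo] --> 0) ->
  exists2 sigma : nat -> nat, (forall j, (j <= sigma j)%N) &
    {ae mu, forall x, D x -> f_ (sigma j) x @[j --> \oo] --> f x}.
Proof.
move=> mD mK KD Kcov mf_ mf lim.
have /choice[sigma Hs] j : exists k : nat, (j <= k)%N /\
    \int[mu]_(x in K j) `|f_ k x - f x|%:E <= (1 / (2 ^ j.+1)%:R)%:E.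
  have ej : 0 < (1 / (2 ^ j.+1)%:R)%:E :> \bar R.
    by rewrite lte_fin divr_gt0// ltr0n expn_gt0.
  have : \forall k \near \oo,
      \int[mu]_(x in K j) `|f_ k x - f x|%:E < (1 / (2 ^ j.+1)%:R)%:E.
    have /fine_cvgP[fin lim0] := lim j.
    have small : \forall k \near \oo,
        (fine (\int[mu]_(x in K j) `|f_ k x - f x|%:E) < 1 / (2 ^ j.+1)%:R)%R.
      by apply: (cvgr_lt _ lim0); rewrite -lte_fin.
    near=> k; rewrite -[X in X < _]fineK; last by near: k.
    by rewrite lte_fin; near: k.
  move=> H; have : \forall k \near \oo, (j <= k)%N /\
    \int[mu]_(x in K j) `|f_ k x - f x|%:E <= (1 / (2 ^ j.+1)%:R)%:E.
    by near=> k; split; [near: k; exact: nbhs_infty_ge|apply: ltW; near: k].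
  move=> /filter_ex[k Hk]; by exists k.
exists sigma; first by move=> j; case: (Hs j).
pose t j x : R := (`|f_ (sigma j) x - f x| * \1_(K j) x)%R.
have t0 j x : (0 <= t j x)%R by rewrite mulr_ge0.
have mt j : measurable_fun D (t j).
  apply: measurable_funM; last by apply: measurable_funTS.
  by apply: measurableT_comp => //; exact: measurable_funB.
have it j : \int[mu]_(x in D) (t j x)%:E <= (1 / (2 ^ j.+1)%:R)%:E.
  apply: le_trans (Hs j).2; rewrite le_eqVlt; apply/orP; left; apply/eqP.
  rewrite -[in RHS](setIidr (KD j)) [RHS]integral_mkcondr; apply: eq_integral => x _.
  by rewrite patchE /t indicE; case: (x \in K j); rewrite ?mulr1 ?mulr0.
have sumint : \int[mu]_(x in D) (\sum_(j <oo) (t j x)%:E) < +oo.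
  rewrite (@integral_nneseries _ _ _ mu D mD (fun j x => (t j x)%:E))//; last 2 first.
    by move=> j; apply/measurable_EFinP; exact: mt.
    by move=> j x _; rewrite lee_fin.
  apply: (@le_lt_trans _ _ (\sum_(j <oo) (1 / (2 ^ j.+1)%:R)%:E)).
    apply: lee_nneseries => [j _ _|j _]; last exact: it.
    by apply: integral_ge0 => x _; rewrite lee_fin.
  by apply: le_lt_trans (epsilon_trick0 _ _) _ => //; rewrite ltry.
have intS : mu.-integrable D (fun x => \sum_(j <oo) (t j x)%:E).
  apply/integrableP; split.
    apply: (@ge0_emeasurable_sum _ _ _ _ (fun j x => (t j x)%:E) xpredT).
      by move=> j x _ _; rewrite lee_fin.
    by move=> j _; apply/measurable_EFinP; exact: mt.
  rewrite (eq_integral (fun x => \sum_(j <oo) (t j x)%:E))// => x _.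
  by rewrite gee0_abs//; apply: nneseries_ge0 => n _ _; rewrite lee_fin.
have := integrable_ae mD intS; apply: filterS => x Hx Dx.
have /(cvg0_of_nneseries (fun j => t0 j x)) tx : \sum_(j <oo) (t j x)%:E < +oo.
  by rewrite ltey_eq Hx.
apply/cvgrPdist_lt => e e0; near=> j.
have Kj : K j x by near: j; exact: Kcov.
have : (`|0 - t j x| < e)%R by near: j; exact: cvgr_dist_lt.
by rewrite sub0r normrN ger0_norm// /t indicE mem_set// mulr1 distrC.
Unshelve. all: by end_near. Qed.

End subsequence.

(** * The annulus *)

Section annulus.
Context {R : realType} {N : nat}.
Implicit Types (rad : \bar R) (x : 'rV[R]_N).
Local Notation mu := (lebesgue_rV N).

Lemma closed_enorm_le (c : R) : closed [set x : 'rV[R]_N | enorm x <= c].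
Proof.
have /continuous_closedP cl := @enorm_continuous R N.
exact: (cl _ (@closed_le R c)).
Qed.

Lemma closed_enorm_ge (c : R) : closed [set x : 'rV[R]_N | c <= enorm x].
Proof.
have /continuous_closedP cl := @enorm_continuous R N.
exact: (cl _ (@closed_ge R c)).
Qed.

Lemma closure_unit_ball : closure (@eball R N 1%E) = [set x | enorm x <= 1].
Proof.
apply/seteqP; split.
  rewrite [X in _ `<=` X](closure_id _).1; last exact: closed_enorm_le.
  by apply: closure_subset => x; rewrite /eball/= lte_fin => /ltW.
move=> x /= x1.
apply: (closed_cvg (fun y => closure (eball 1%E) y) (@closed_closure _ _)
  (u_ := fun k : nat => (1 - k.+1%:R^-1) *: x) (F := \oo)).
  apply: nearW => k; apply: subset_closure; rewrite /eball/= lte_fin.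
  have k1 : k.+1%:R^-1 <= 1 :> R by rewrite invf_le1// ler1n.
  rewrite enormZ ?subr_ge0//.
  have k2 : 1 - k.+1%:R^-1 < 1 :> R by rewrite gtrBl invr_gt0.
  by apply: le_lt_trans k2; apply: ler_piMr; rewrite ?subr_ge0.
have lim1 : (fun k : nat => 1 - k.+1%:R^-1 : R) @ \oo --> (1 - 0 : R).
  by apply: cvgB; [exact: cvg_cst|exact: cvg_harmonic].
by rewrite subr0 in lim1; rewrite -[X in _ --> X]scale1r; exact: cvgZr_tmp.
Qed.

Lemma annulusE rad x :
  (eball rad `\` closure (eball 1%E)) x <-> 1 < enorm x /\ ((enorm x)%:E < rad)%E.
Proof.
rewrite closure_unit_ball /eball/=; split=> [[xr /negP]|[x1 xr]].
  by rewrite -ltNge.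
by split => //; apply/negP; rewrite -ltNge.
Qed.

Lemma measurable_shell rad : measurable [set r : R | 1 < r /\ (r%:E < rad)%E].
Proof.
rewrite (_ : [set r | _] = `]1, +oo[%classic `&` (EFin @^-1` [set y | y < rad]%E)).
  apply: measurableI => //.
  rewrite -[X in measurable X]setTI; apply: EFin_measurable => //.
  rewrite (_ : [set y | _] = [set` Interval -oo%O (BLeft rad)]).
    exact: emeasurable_itv.
  by apply/seteqP; split => y /=; rewrite in_itv.
by apply/seteqP; split => r /=; rewrite in_itv/= andbT.
Qed.

Lemma measurable_annulus rad : measurable (eball rad `\` closure (@eball R N 1%E)).
Proof.
rewrite (_ : _ `\` _ = @enorm R N @^-1` [set r : R | 1 < r /\ (r%:E < rad)%E]).
  rewrite -[X in measurable X]setTI; apply: measurable_enorm => //.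
  exact: measurable_shell.
by apply/seteqP; split => x /annulusE.
Qed.

(** Closed shells [1 + 1 / (j + 1) <= |x| <= b j] with [b j] below the outer radius and
    tending to it. *)
Lemma annulus_exhaustion rad : exists K : nat -> set 'rV[R]_N,
  [/\ forall j, compact (K j),
      forall j, K j `<=` eball rad `\` closure (eball 1%E) &
      forall x, (eball rad `\` closure (eball 1%E)) x -> \forall j \near \oo, K j x].
Proof.
have [b brad blim] : exists2 b : nat -> R, forall j, ((b j)%:E < rad)%E \/ b j <= 0 &
    forall c : R, (c%:E < rad)%E -> \forall j \near \oo, c <= b j.
  case: rad => [r| |].
  - exists (fun j => r - j.+1%:R^-1) => [j|c].
      by left; rewrite lte_fin gtrBl invr_gt0.
    rewrite lte_fin -subr_gt0 => cr.
    near=> j; rewrite lerBrDl -lerBrDr.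
    near: j; have := @cvg_harmonic R => /cvgrPdist_le/(_ _ cr).
    by apply: filterS => j; rewrite sub0r normrN ger0_norm// /harmonic/= invr_ge0.
  - exists (fun j => j%:R) => [j|c _]; first by left; rewrite ltry.
    exact: nbhs_infty_ger.
  - by exists (fun=> 0) => [j|c]; [right|rewrite ltNge leNye].
exists (fun j => [set x | 1 + j.+1%:R^-1 <= enorm x] `&` [set x | enorm x <= b j]); split.
- move=> j; apply: (subclosed_compact _ (@compact_cube R N (b j))).
    by apply: closedI; [exact: closed_enorm_ge|exact: closed_enorm_le].
  by move=> x [_ /= xb] i; rewrite (le_trans (coord_le_enorm _ _)).
- move=> j x [/= x1 xb]; apply/annulusE; split.
    by rewrite (lt_le_trans _ x1)// ltrDl invr_gt0.
  have [bj|bj] := brad j; first by rewrite (le_lt_trans _ bj)// lee_fin.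
  suff: 1 + j.+1%:R^-1 <= 0 :> R by rewrite leNgt ltr_wpDr// invr_ge0.
  exact: le_trans x1 (le_trans xb bj).
- move=> x /annulusE[x1 xr]; near=> j; split => /=; last by near: j; exact: blim.
  rewrite -lerBrDl; near: j.
  have := @cvg_harmonic R => /cvgrPdist_le/(_ (enorm x - 1)).
  rewrite subr_gt0 => /(_ x1); apply: filterS => j.
  by rewrite sub0r normrN ger0_norm// /harmonic/= invr_ge0.
Unshelve. all: by end_near. Qed.

End annulus.

(** * Test functions and weights on the annulus *)

Section main.
Context {R : realType} {N : nat}.
Implicit Types (rad : \bar R) (W : R -> \bar R).
Local Notation mu := (lebesgue_rV N).
Local Notation leb := (@lebesgue_measure R).
Local Notation annulus rad := (eball rad `\` closure (@eball R N 1%E)).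
Local Open Scope ereal_scope.

Lemma test_function_estimate rad (phi : 'rV[R]_N -> R) W : (2 <= N)%N ->
  test_function (annulus rad) phi ->
  measurable_fun setT W -> (forall r, 0 <= W r) -> (forall r, (r <= 1)%R -> W r = 0) ->
  \int[mu]_x (W (enorm x) * (phi x ^+ 2)%:E) <=
  \int[leb]_r (W r * (r ^+ N.+1 * radial_factor N r)%:E) *
  \int[mu]_(x in annulus rad) (laplacian phi x ^+ 2)%:E.
Proof.
move=> N2 [sphi cphi Sphi] mW W0 W1.
set S := closure [set x | phi x != 0%R] in cphi Sphi.
have cS : closed S by exact: closed_closure.
have phi0 y : ~ S y -> phi y = 0%R.
  by move=> nS; apply/eqP/negPn/negP => py; apply: nS; exact: subset_closure.
have S1 : S `<=` [set y | (1 < enorm y)%R] by move=> y /Sphi/annulusE[].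
have [L SL] : exists L : R, S `<=` cube L.
  have /compact_bounded[M [_ HM]] : compact (@enorm R N @` S).
    by apply: continuous_compact => //; exact/continuous_subspaceT/enorm_continuous.
  exists (`|M| + 1)%R => y Sy i; rewrite (le_trans (coord_le_enorm _ _))//.
  rewrite (le_trans (ler_norm _))//; apply: HM; last by exists y.
  by rewrite (le_lt_trans (ler_norm M))// ltrDl.
have phiL x : ~ cube L x -> phi x = 0%R by move=> nL; apply: phi0 => /SL.
have -> : \int[mu]_(x in annulus rad) (laplacian phi x ^+ 2)%:E =
    \int[mu]_x (hessian_sqr phi x)%:E.
  rewrite (integral_hessian_sqr sphi phiL) integral_mkcond; apply: eq_integral => x _.
  rewrite patchE; case: ifPn => //; rewrite notin_setE => nO.
  rewrite /laplacian big1 ?expr0n// => i _.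
  by apply: (partial_eq0_outside i cS (partial_eq0_outside i cS phi0)) => /Sphi.
exact: (weighted_estimate N2 sphi cS S1 phi0 mW W0 W1).
Qed.

(** [W] is the absolute value of a Borel representative of [w], raised to infinity on
    a Borel null set containing the points where the two differ.  Thus [w <= W]
    holds everywhere, as is needed to compare with [g] at every point, while
    the integrals are unchanged. *)
Lemma exists_borel_majorant rad (rho w : R -> R) :
  let I := [set r : R | (1 < r)%R /\ r%:E < rad] in
  measurable_fun setT rho -> (forall r, I r -> (0 <= rho r)%R) ->
  weighted_L1 I rho w ->
  exists W : R -> \bar R, [/\ measurable_fun setT W, forall r, 0 <= W r,
    forall r, ~ I r -> W r = 0, forall r, I r -> (w r)%:E <= W r &
    \int[leb]_r (W r * (rho r)%:E) < +oo].
Proof.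
move=> I mrho rho0 [[h mh [Z [mZ Z0 HZ]]] wL1].
have mI : measurable I by exact: measurable_shell.
pose A : R -> \bar R := (fun r => `|h r|%:E) \_ I.
pose B : R -> \bar R := (cst +oo) \_ (I `&` Z).
have A0 r : 0 <= A r by rewrite /A patchE; case: ifP.
have B0 r : 0 <= B r by rewrite /B patchE; case: ifP => //= _; exact: leey.
have mA : measurable_fun setT A.
  apply/(measurable_restrictT _ _).1 => //; apply/measurable_EFinP.
  by apply: measurableT_comp.
have mB : measurable_fun setT B.
  by apply/(measurable_restrictT _ _).1 => //; exact: measurableI.
have hw r : I r -> ~ Z r -> w r = h r.
  by move=> Ir nZ; apply: contrapT => wh; apply: nZ; apply: HZ => /= /(_ Ir).
exists (fun r => A r + B r); split.
- exact: emeasurable_funD.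
- by move=> r; exact: adde_ge0.
- by move=> r nI; rewrite /A /B !patchE !memNset ?adde0// => -[].
- move=> r Ir; have [Zr|nZ] := pselect (Z r).
    by rewrite [B r]patchE mem_set//= addey ?leey// -ltNye (lt_le_trans _ (A0 r)).
  rewrite [A r]patchE mem_set// (hw _ Ir nZ) (le_trans _ (leeDl _ (B0 r)))//.
  by rewrite lee_fin ler_norm.
apply: le_lt_trans wL1.
rewrite [leRHS]integral_mkcond.
apply: (measurable_le_integral_ae measurableT mZ Z0).
- apply: emeasurable_funM; first exact: emeasurable_funD.
  exact/measurable_EFinP.
- move=> r _; have [Ir|nI] := pselect (I r).
    by rewrite mule_ge0 ?lee_fin ?rho0// adde_ge0.
  by rewrite /A /B !patchE !memNset ?adde0 ?mul0e// => -[].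
- by move=> r _; rewrite erestrict_ge0// => s Is; rewrite lee_fin mulr_ge0// rho0.
- move=> r _ nZ; rewrite [B r]patchE memNset; last by case.
  rewrite adde0 /A !patchE; case: ifPn => [/set_mem Ir|_]; last by rewrite mul0e.
  by rewrite (hw _ Ir nZ) -EFinM.
Qed.

(** The three integrability conditions, in a common form: the weight
    [r ^+ N.+1 * radial_factor N r] is at most a multiple of a weight [rho] for which
    [w] is integrable. *)
Lemma exists_weight rad (w : R -> R) :
  let I := [set r : R | (1 < r)%R /\ r%:E < rad] in
  (2 <= N <= 4)%N -> 1 <= rad ->
  (N = 3%N \/ N = 4%N -> rad = +oo ->
     weighted_L1 I (fun r => r ^+ N.+1)%R w) ->
  (N = 2%N -> rad = +oo ->
     weighted_L1 I (fun r => r ^+ 3 * ln r)%R w) ->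
  (rad < +oo -> weighted_L1 I (fun=> 1%R) w) ->
  exists rho : R -> R, exists C : R, [/\ measurable_fun setT rho,
    (0 <= C)%R, forall r, I r -> (0 <= rho r)%R, weighted_L1 I rho w &
    forall r, I r -> (r ^+ N.+1 * radial_factor N r <= C * rho r)%R].
Proof.
move=> I N24 rad1 H34 H2 Hfin.
have [radoo|radfin] := eqVneq rad +oo.
  have [Ne2|Nn2] := eqVneq N 2%N.
    exists (fun r => r ^+ 3 * ln r)%R, 1%R; split => //.
    - by apply: measurable_funM => //; exact: measurable_ln.
    - move=> r [r1 _]; rewrite mulr_ge0 ?ln_ge0 ?(ltW r1)// exprn_ge0//.
      exact: (le_trans ler01 (ltW r1)).
    - exact: H2.
    - by move=> r _; rewrite mul1r /radial_factor Ne2 eqxx.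
  exists (fun r => r ^+ N.+1)%R, 1%R; split => //.
  - by move=> r [r1 _]; rewrite exprn_ge0// (le_trans ler01 (ltW r1)).
  - by apply: H34 => //; move: N24 Nn2; case: (N) => [|[|[|[|[|]]]]]//=; auto.
  - by move=> r _; rewrite mul1r /radial_factor (negbTE Nn2) mulr1.
have radlt : rad < +oo by rewrite ltey.
have [r0 radE] : exists r0 : R, rad = r0%:E.
  by case: (rad) rad1 radlt => // r _ _; exists r.
have r01 : (1 <= r0)%R by rewrite -lee_fin -radE.
exists (fun=> 1%R), (r0 ^+ N.+1 * radial_factor N r0)%R; split => //.
- by rewrite mulr_ge0 ?radial_factor_ge0// exprn_ge0// (le_trans ler01).
- exact: Hfin.
move=> r [r1]; rewrite radE lte_fin mulr1 => rr0.
have r00 : (0 < r)%R by exact: lt_trans r1.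
apply: ler_pM; rewrite ?radial_factor_ge0 ?exprn_ge0 ?(ltW r1) ?(ltW r00)//.
  by rewrite lerXn2r// ?nnegrE ltW// (lt_trans r00).
rewrite /radial_factor; case: ifP => // _.
by rewrite ler_ln ?posrE ?(ltW rr0)// (lt_trans r00).
Qed.

End main.

(** * Passage to the completion *)

Section liminf.
Context {R : realType}.
Local Open Scope ereal_scope.

Lemma limn_einf_ge (u : (\bar R)^nat) (a : \bar R) :
  (forall n, a <= u n) -> a <= limn_einf u.
Proof.
move=> au; rewrite limn_einf_lim; apply: lime_ge; first exact: is_cvg_einfs.
by apply: nearW => n; apply: le_ereal_inf_tmp => _ [m _ <-].
Qed.

Lemma limn_einf_le_cvg (u b : (\bar R)^nat) (l : \bar R) :
  (forall n, u n <= b n) -> b @ \oo --> l -> limn_einf u <= l.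
Proof.
move=> ub bl; rewrite limn_einf_lim; apply: lime_le; first exact: is_cvg_einfs.
apply: nearW => n; apply: (cvge_ge _ bl); near=> m.
apply: le_trans (ub m); apply: ereal_inf_lbound; exists m => //=.
by near: m; exact: nbhs_infty_ge.
Unshelve. all: by end_near. Qed.

(** For infinite [W] and [c = 0] the products need not converge, but then the
    left-hand side is zero. *)
Lemma mule_sqr_le_limn_einf (W : \bar R) (f : nat -> R) (c : R) : 0 <= W ->
  f @ \oo --> c -> W * (c ^+ 2)%:E <= limn_einf (fun j => W * (f j ^+ 2)%:E).
Proof.
move=> W0 fc.
have f2 : (fun j => f j ^+ 2)%R @ \oo --> (c ^+ 2)%R.
  by apply: (@cvg_comp _ _ _ f (fun z : R => z ^+ 2)%R _ _ _ fc); exact: exprn_continuous.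
have [->|c0] := eqVneq c 0%R.
  rewrite expr0n mule0; apply: limn_einf_ge => n.
  by rewrite mule_ge0// lee_fin sqr_ge0.
suff /cvg_limn_einf_sup[-> _] :
  (fun j => W * (f j ^+ 2)%:E) @ \oo --> W * (c ^+ 2)%:E by [].
apply: cvgeM; last 2 first.
- exact: cvg_cst.
- by apply: cvg_EFin => //; exact: nearW.
have c2 : (c ^+ 2 != 0)%R by rewrite sqrf_eq0.
by rewrite /mule_def; case: (W).
Qed.
End liminf.

Section admissibility.
Context {R : realType} {N : nat}.
Local Notation mu := (lebesgue_rV N).
Local Notation leb := (@lebesgue_measure R).
Local Notation annulus rad := (eball rad `\` closure (@eball R N 1%E)).
Local Open Scope ereal_scope.

(** [U] and [V] are Borel representatives of [u] and [v].  The estimate for test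
    functions passes to [U] by Fatou's lemma along a subsequence converging almost
    everywhere; the Laplacians of the test functions are compared with [v] by
    [a ^ 2 <= 2 (a - b) ^ 2 + 2 b ^ 2], which is enough as only some constant is
    asked for. *)
Lemma admissible_of_weight (rad : \bar R) (g : 'rV[R]_N -> R) (W : R -> \bar R) :
  (2 <= N)%N -> measurable_fun setT W -> (forall r, 0 <= W r) ->
  (forall r, (r <= 1)%R -> W r = 0) ->
  \int[leb]_r (W r * (r ^+ N.+1 * radial_factor N r)%:E) < +oo ->
  (forall x, annulus rad x -> (0 <= g x)%R) ->
  (forall x, annulus rad x -> (g x)%:E <= W (enorm x)) ->
  admissible (annulus rad) g.
Proof.
move=> N2 mW W0 W1 Wfin g0 gW.
set Om := annulus rad.
have mOm : measurable Om by exact: measurable_annulus.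
pose IW := \int[leb]_r (W r * (r ^+ N.+1 * radial_factor N r)%:E).
have IW0 : 0 <= IW.
  apply: integral_ge0 => r _; have [r1|r1] := leP r 1%R; first by rewrite W1// mul0e.
  rewrite mule_ge0// lee_fin mulr_ge0 ?radial_factor_ge0 ?(ltW r1)// exprn_ge0//.
  exact: (le_trans ler01 (ltW r1)).
pose C := fine IW.
have IWE : IW = C%:E by rewrite fineK// ge0_fin_numE.
have C0 : (0 <= C)%R by exact: fine_ge0.
exists (2 * C + 1)%R; first by rewrite ltr_wpDl// mulr_ge0.
move=> u v [[U mU [Zu [mZu Zu0 HZu]]] [V mV [Zv [mZv Zv0 HZv]]] [phi [Tphi Lv Lu]]].
have uU x : Om x -> ~ Zu x -> u x = U x.
  by move=> Ox nZ; apply: contrapT => ne; apply: nZ; apply: HZu => /= /(_ Ox).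
have vV x : Om x -> ~ Zv x -> v x = V x.
  by move=> Ox nZ; apply: contrapT => ne; apply: nZ; apply: HZv => /= /(_ Ox).
pose J := \int[mu]_(x in Om) (v x ^+ 2)%:E.
pose e k := \int[mu]_(x in Om) ((laplacian (phi k) x - v x) ^+ 2)%:E.
have J0 : 0 <= J by apply: integral_ge0 => x _; rewrite lee_fin sqr_ge0.
have mphi k : measurable_fun Om (phi k).
  apply: measurable_funTS; apply: continuous_measurable_rV.
  by have [s _ _] := Tphi k; exact: (s [::]).1.
have mlap k : measurable_fun Om (laplacian (phi k)).
  apply: measurable_funTS; apply: continuous_measurable_rV; apply: continuous_sumr => i.
  by have [s _ _] := Tphi k; exact: (s [:: i; i]).1.
have lap_le k : \int[mu]_(x in Om) (laplacian (phi k) x ^+ 2)%:E <= 2%:E * e k + 2%:E * J.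
  have m1 : measurable_fun Om (fun x => ((laplacian (phi k) x - V x) ^+ 2)%:E).
    by apply/measurable_EFinP; apply: measurable_funX; exact: measurable_funB.
  have m2 : measurable_fun Om (fun x => (V x ^+ 2)%:E).
    by apply/measurable_EFinP; exact: measurable_funX.
  have e_ge : \int[mu]_(x in Om) ((laplacian (phi k) x - V x) ^+ 2)%:E <= e k.
    apply: (measurable_le_integral_ae mOm mZv Zv0 m1).
    - by move=> x _; rewrite lee_fin sqr_ge0.
    - by move=> x _; rewrite lee_fin sqr_ge0.
    - by move=> x Ox nZ; rewrite (vV _ Ox nZ).
  have J_ge : \int[mu]_(x in Om) (V x ^+ 2)%:E <= J.
    apply: (measurable_le_integral_ae mOm mZv Zv0 m2).
    - by move=> x _; rewrite lee_fin sqr_ge0.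
    - by move=> x _; rewrite lee_fin sqr_ge0.
    - by move=> x Ox nZ; rewrite (vV _ Ox nZ).
  apply: (@le_trans _ _ (2%:E * \int[mu]_(x in Om) ((laplacian (phi k) x - V x) ^+ 2)%:E +
     2%:E * \int[mu]_(x in Om) (V x ^+ 2)%:E)); last by apply: leeD; apply: lee_wpmul2l.
  rewrite -!ge0_integralZl//; last 2 first.
  - by move=> x _; rewrite lee_fin sqr_ge0.
  - by move=> x _; rewrite lee_fin sqr_ge0.
  rewrite -ge0_integralD//; last 4 first.
  - by move=> x _; rewrite -EFinM lee_fin mulr_ge0// sqr_ge0.
  - exact: measurable_funeM.
  - by move=> x _; rewrite -EFinM lee_fin mulr_ge0// sqr_ge0.
  - exact: measurable_funeM.
  apply: ge0_le_integral_any => x _; first by rewrite lee_fin sqr_ge0.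
  rewrite -!EFinM -EFinD lee_fin -subr_ge0.
  set a := laplacian _ _; set b := V x.
  by rewrite (_ : _ - _ = (a - 2 * b) ^+ 2)%R ?sqr_ge0//; ring.
have [K [cK KOm Kcov]] := @annulus_exhaustion R N rad.
have mK j : measurable (K j).
  apply: closed_measurable_rV; apply: compact_closed; last exact: cK.
  exact: norm_hausdorff.
have limU j : \int[mu]_(x in K j) `|phi k x - U x|%:E @[k --> \oo] --> 0.
  apply: (squeeze_cvge _ (cvg_cst 0) (Lu (K j) (cK j) (KOm j))).
  apply: nearW => k; apply/andP; split.
    by apply: integral_ge0 => x _; rewrite lee_fin.
  apply: (measurable_le_integral_ae (mK j) mZu Zu0).
  - apply/measurable_EFinP; apply: measurableT_comp => //; apply: measurable_funB.
      exact: (measurable_funS mOm (KOm j)).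
    exact: (measurable_funS mOm (KOm j)).
  - by move=> x _; rewrite lee_fin.
  - by move=> x _; rewrite lee_fin.
  - by move=> x /KOm Ox nZ; rewrite (uU _ Ox nZ).
have [sigma sigma_ge [Zs [mZs Zs0 HZs]]] :=
  L1loc_ae_subsequence mOm mK KOm Kcov mphi mU limU.
have mWe : measurable_fun Om (fun x => W (enorm x)).
  by apply: measurable_funTS; exact: (measurableT_comp mW (@measurable_enorm R N)).
have WUJ : \int[mu]_(x in Om) (W (enorm x) * (U x ^+ 2)%:E) <= C%:E * (2%:E * J).
  apply: (@le_trans _ _ (\int[mu]_(x in Om)
     limn_einf (fun j => W (enorm x) * (phi (sigma j) x ^+ 2)%:E))).
    apply: (measurable_le_integral_ae mOm mZs Zs0).
    - apply: emeasurable_funM => //; apply/measurable_EFinP; exact: measurable_funX.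
    - by move=> x _; rewrite mule_ge0// lee_fin sqr_ge0.
    - by move=> x _; apply: limn_einf_ge => j; rewrite mule_ge0// lee_fin sqr_ge0.
    - move=> x Ox nZ; apply: mule_sqr_le_limn_einf => //.
      by apply: contrapT => nc; apply: nZ; apply: HZs => /= /(_ Ox).
  apply: le_trans (fatou mu mOm _ _) _.
  - move=> j; apply: emeasurable_funM => //; apply/measurable_EFinP; exact: measurable_funX.
  - by move=> j x _; rewrite mule_ge0// lee_fin sqr_ge0.
  apply: (@limn_einf_le_cvg _ _ (fun j => C%:E * (2%:E * e (sigma j) + 2%:E * J))).
    move=> j; apply: (@le_trans _ _ (\int[mu]_x (W (enorm x) * (phi (sigma j) x ^+ 2)%:E))).
      rewrite integral_mkcond; apply: ge0_le_integral_any => x _.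
        by apply: erestrict_ge0 => y _; rewrite mule_ge0// lee_fin sqr_ge0.
      by rewrite patchE; case: ifP => // _; rewrite mule_ge0// lee_fin sqr_ge0.
    apply: le_trans (test_function_estimate N2 (Tphi (sigma j)) mW W0 W1) _.
    by rewrite -/IW IWE lee_wpmul2l.
  have es : (fun j => e (sigma j)) @ \oo --> 0.
    apply: (cvg_comp sigma e _ Lv); apply/cvgnyPge => m; near=> j.
    by apply: leq_trans (sigma_ge j); near: j; exact: nbhs_infty_ge.
  rewrite -[X in _ --> _ * X]add0e -[X in _ --> _ * (X + _)](mule0 2%:E).
  apply: cvgeZl => //; apply: cvgeD => //; last exact: cvg_cst.
  exact: cvgeZl.
apply: (@le_trans _ _ (\int[mu]_(x in Om) (W (enorm x) * (U x ^+ 2)%:E))).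
  apply: (le_measurable_integral_ae mOm mZu Zu0).
  - apply: emeasurable_funM => //; apply/measurable_EFinP; exact: measurable_funX.
  - by move=> x Ox; rewrite lee_fin mulr_ge0 ?g0// sqr_ge0.
  - by move=> x _; rewrite mule_ge0// lee_fin sqr_ge0.
  - move=> x Ox nZ; rewrite (uU _ Ox nZ) EFinM lee_wpmul2r ?gW//.
    by rewrite lee_fin sqr_ge0.
apply: (le_trans WUJ); rewrite muleA -EFinM lee_wpmul2r// lee_fin mulrC lerDl.
Unshelve. all: by end_near. Qed.

End admissibility.

Theorem theorem1p5 (R : realType) (N : nat) (rad : \bar R)
    (g : 'rV[R]_N -> R) (w : R -> R) :
  let Omega : set 'rV[R]_N := eball rad `\` closure (eball 1%E) in
  let I : set R := [set r : R | 1 < r /\ (r%:E < rad)%E] in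
  (2 <= N <= 4)%N ->
  (1 <= rad)%E ->
  ae_measurable (lebesgue_rV N) Omega g ->
  (forall x, Omega x -> 0 <= g x) ->
  (forall x, Omega x -> g x <= w (enorm x)) ->
  (N = 3%N \/ N = 4%N -> rad = +oo%E ->
     weighted_L1 I (fun r => r ^+ N.+1) w) ->
  (N = 2%N -> rad = +oo%E ->
     weighted_L1 I (fun r => r ^+ 3 * ln r) w) ->
  ((rad < +oo)%E -> weighted_L1 I (fun=> 1) w) ->
  admissible Omega g.
Proof.
move=> Omega I N24 rad1 _ g0 gw H34 H2 Hfin.
have [rho [C [mrho C0 rho0 wL1 hC]]] := exists_weight N24 rad1 H34 H2 Hfin.
have [W [mW W0 WI wW Wint]] := exists_borel_majorant mrho rho0 wL1.
have N2 : (2 <= N)%N by case/andP: N24.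
have Wrho0 r : (0 <= W r * (rho r)%:E)%E.
  have [Ir|nI] := pselect (I r); last by rewrite (WI _ nI) mul0e.
  by rewrite mule_ge0// lee_fin rho0.
apply: (@admissible_of_weight _ _ _ _ W) => //.
- by move=> r r1; apply: WI => -[]; rewrite ltNge r1.
- have mWrho : measurable_fun setT (fun r => W r * (rho r)%:E)%E.
    by apply: emeasurable_funM => //; exact/measurable_EFinP.
  apply: (@le_lt_trans _ _ (\int[lebesgue_measure]_r (C%:E * (W r * (rho r)%:E)))%E).
    apply: ge0_le_integral_any => r _; have [Ir|nI] := pselect (I r).
    + rewrite mule_ge0// lee_fin mulr_ge0 ?radial_factor_ge0 ?(ltW Ir.1)//.
      by rewrite exprn_ge0// (le_trans ler01 (ltW Ir.1)).
    + by rewrite (WI _ nI) mul0e.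
    + by rewrite muleCA -EFinM lee_wpmul2l// lee_fin hC.
    + by rewrite (WI _ nI) !mul0e mule0.
  by rewrite ge0_integralZl// lte_mul_pinfty.
- move=> x Ox; have Ix : I (enorm x) by apply/annulusE.
  by apply: le_trans (wW _ Ix); rewrite lee_fin gw.
Qed.
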